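(* Let $T \geq 1$ be an integer and let $f: \mathbb{Z} \to \mathbb{C}$ satisfy $f(n+T)=f(n)$ for all $n\in\mathbb{Z}$, with $f$ not identically zero. Let $E\subset\mathbb{C}$ be a finite-dimensional $\mathbb{Q}$-vector space, $p\in\{0,1\}$ and $\varepsilon>0$. Then for every integer $a$ sufficiently large in terms of $\dim E$, $T$ and $\varepsilon$, at least $2^{(1-\varepsilon)\frac{\log a}{\log \log a}}$ of the numbers $L(f,s)$ with $2\leq s\leq a$ and $s\equiv p \bmod 2$ do not belong to $E$.
   Context: For an integer $s\geq 2$, $L(f,s)=\sum_{n=1}^\infty f(n)n^{-s}$. *)

(* Defs.v *)
From mathcomp Require Import all_boot all_order all_algebra.
From mathcomp Require Import all_classical all_reals all_analysis.
From mathcomp Require Import complex.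

Set Implicit Arguments.
Unset Strict Implicit.
Unset Printing Implicit Defensive.

Import Order.TTheory GRing.Theory Num.Theory numFieldNormedType.Exports.
Local Open Scope classical_set_scope.
Local Open Scope ring_scope.

(** The type [R[i]] carries no topology by itself; the cast to [R[i]^o] selects
    the one induced by the modulus. The index is shifted so that the series
    starts at [n = 1]. The limit is meaningful for [2 <= s] and [f] bounded,
    since the series then converges absolutely. *)
Definition Lseries (R : realType) (f : int -> R[i]) (s : nat) : R[i] :=
  limn (series (fun n : nat => f n.+1%:Z / n.+1%:R ^+ s) : nat -> R[i]^o).

Definition rat_free (R : realType) (d : nat) (b : 'I_d -> R[i]) : Prop :=
  forall c : 'I_d -> rat,
    \sum_(i < d) ratr (c i) * b i = 0 -> forall i, c i = 0.

Definition rat_span (R : realType) (d : nat) (b : 'I_d -> R[i]) : set R[i] :=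
  [set x | exists c : 'I_d -> rat, x = \sum_(i < d) ratr (c i) * b i].

(** [E] is a linear subspace of [R[i]] over [rat] having a basis with [d]
    elements; that it is a subspace follows from its being a span. *)
Definition rat_subspace_dim (R : realType) (E : set R[i]) (d : nat) : Prop :=
  exists b : 'I_d -> R[i], rat_free b /\ E = rat_span b.

(* Main.v *)
(** Let [D] have many divisors [e], put [q = D T], and let [R] be a rational
    function with poles of order [b] at [0, -1, ..., -n], invariant up to sign
    under [x -> - n - x]. Since [f] has period [T], partial fractions turn
    [sum_m f(m) R(e m / q)] into a linear form in the [L(f, s)], [s <= b], with
    [s] of one parity, and in the values of [f]; the coefficient of [L(f, s)]
    depends on [e] only through the factor [(q / e) ^ s]. If few of the
    [L(f, s)] lie outside [E], integer weights [w_e], not all zero, eliminate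
    them.

    The weighted sum of these forms samples [R] on [(1 / q) Z], the point
    [m / q] having as weight the Dirichlet convolution of [w] and [f], which is
    periodic modulo [q] and nonzero at some [c <= q]. Choosing [R] to vanish at
    every [m / q] with [1 <= m <= c + 4 k n] except [m = c + k n], where [q]
    divides [k], leaves one explicit nonzero term and an exponentially smaller
    tail. So no cancellation between values of [f] can occur, and the forms in
    a basis of [E] and the values of [f] are small, but not too small, for
    every large [n] of a given parity. A linear independence criterion of
    Nesterenko type excludes this when [k / q] is large in terms of [dim E] and
    [T]. Taking [D] to be a product of about [log a / log log a] primes, of
    size [a ^ (1 - eps / 2)], gives the bound of the theorem. *)
Require Import Defs.
From mathcomp Require Import all_boot all_order all_algebra.
From mathcomp Require Import all_classical all_reals all_analysis.
From mathcomp Require Import complex.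
From mathcomp Require Import zify ring lra.
Import Order.TTheory GRing.Theory Num.Theory numFieldNormedType.Exports.

Set Implicit Arguments.
Unset Strict Implicit.
Unset Printing Implicit Defensive.

(** * Primes and least common multiples *)

(** The sizes in competition are those of the zeros and of the poles. At most [12 k] blocks of [n]
    zeros multiply the main value of [R] by at most [(64 k) ^ (12 k n)], while each of the [b] pole
    factors gains about [(k / q) ^ n]. The single inequality [2 (64 k) ^ (12 k) <= 2 ^ b] caps the
    cost of the zeros at [2 ^ (b n)]; hence [k log k] must stay below a multiple of [a], and [D]
    below [a ^ (1 - eps / 2)]. All other losses, such as [lcm(1, ..., n) ^ b], are [2 ^ (O(b n))]
    with absolute constants, so [k / q = 2 ^ g] wins once [g] exceeds a multiple of the number
    [d + T] of coordinates. The main term needs no asymptotics: at a grid point a block is a product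
    of [n] consecutive integers, so it is at least [n!] in absolute value unless it is 0. The zeros
    at negative grid points serve arithmetic: the coefficients of the values of [f] have
    denominators built from integers up to [n q], and these zeros reduce them to powers of
    [lcm(1, ..., n)]. The exponent [s = 1] is eliminated with the others, as [L(f, 1)] may
    diverge. *)

Lemma logn_central_bin p n : prime p ->
  logn p 'C(n.*2, n) =
  \sum_(1 <= k < n.*2.+1) (n.*2 %/ p ^ k - (n %/ p ^ k).*2).
Proof.
move=> pp.
have ext : logn p n`! = \sum_(1 <= k < n.*2.+1) n %/ p ^ k.
  rewrite logn_fact // (@big_cat_nat _ _ _ n.+1 _ n.*2.+1) //=; last by lia.
  rewrite [X in _ = _ + X]big_nat_cond [X in _ = _ + X]big1 ?addn0 // => k /andP[/andP[nk _] _].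
  by rewrite divn_small // (leq_trans _ (ltn_expl k (prime_gt1 pp))) // ltnW.
have E := @bin_fact n.*2 n ltac:(lia).
have -> : logn p 'C(n.*2, n) = logn p (n.*2)`! - (logn p n`!).*2.
  rewrite -E -[in n.*2 - n]addnn addnK !lognM ?muln_gt0 ?fact_gt0 ?bin_gt0; lia.
rewrite ext logn_fact // -[X in _ - X]muln2 big_distrl /= -sumnB => [|k _].
  by apply: eq_bigr => k _; rewrite muln2.
by rewrite leq_divRL ?expn_gt0 ?prime_gt0 // -!muln2 mulnAC leq_mul2r leq_trunc_div orbT.
Qed.

(** In Legendre's formula each term is 0 or 1, and only those with [p ^ k <= 2 n] can be nonzero. *)
Lemma pfactor_central_bin_le p n : prime p -> 0 < n ->
  p ^ logn p 'C(n.*2, n) <= n.*2.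
Proof.
move=> pp n0; have p1 := prime_gt1 pp.
apply: leq_trans (trunc_logP p1 _); last by rewrite double_gt0.
rewrite leq_exp2l // logn_central_bin //.
set L := trunc_log p n.*2.
have LL : L <= n.*2.
  by apply: ltnW; apply: (leq_trans (ltn_expl L p1)); apply: trunc_logP; rewrite ?double_gt0.
rewrite (@big_cat_nat _ _ _ L.+1) //=.
rewrite [X in _ + X <= _]big_nat_cond [X in _ + X <= _]big1 ?addn0; last first.
  move=> k /andP[/andP[Lk _] _]; rewrite divn_small //.
  by apply: leq_trans (trunc_log_ltn _ p1) _; rewrite leq_exp2l.
apply: (@leq_trans (\sum_(1 <= k < L.+1) 1)); last by rewrite sum_nat_const_nat; lia.
apply: leq_sum => k _; have d0 : 0 < p ^ k by rewrite expn_gt0 prime_gt0.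
have := divn_eq n (p ^ k); have := ltn_pmod n d0.
have := divn_eq n.*2 (p ^ k); have := ltn_pmod n.*2 d0.
set a := n %/ _; set b := n %% _; set c := _ %/ _; set e := _ %% _; nia.
Qed.

Lemma expn2_le_central_bin n : 2 ^ n <= 'C(n.*2, n).
Proof.
elim: n => // n IH; rewrite doubleS expnS mul2n.
have e : 'C(n.*2.+1, n) = 'C(n.*2.+1, n.+1) by rewrite -bin_sub; [congr 'C(_, _); lia|lia].
rewrite binS e addnn leq_double.
by rewrite binS (leq_trans IH) // leq_addl.
Qed.

(** A Chebyshev lower bound for the number of primes: those dividing the central binomial
    coefficient are at most [2 n], and each contributes at most [2 n] to it. *)
Lemma expn2_le_primes n : 0 < n ->
  2 ^ n <= n.*2 ^ size [seq p <- iota 0 n.*2.+1 | prime p].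
Proof.
move=> n0; apply: leq_trans (expn2_le_central_bin n) _.
have C0 : 0 < 'C(n.*2, n) by rewrite bin_gt0; lia.
rewrite {1}(prod_prime_decomp C0) prime_decompE big_map /=.
apply: (@leq_trans (\prod_(p <- primes 'C(n.*2, n)) n.*2)).
  rewrite big_seq [X in _ <= X]big_seq.
  apply: leq_prod => p; rewrite mem_primes => /and3P[pp _ _].
  exact: pfactor_central_bin_le.
rewrite big_const_seq count_predT iter_muln_1 leq_pexp2l ?double_gt0 //.
apply: uniq_leq_size; first exact: primes_uniq.
move=> p; rewrite mem_filter mem_iota mem_primes => /and3P[pp _ pd].
rewrite pp /=; suff : p <= n.*2 by lia.
apply: leq_trans (pfactor_central_bin_le pp n0).
by rewrite -{1}(expn1 p) leq_exp2l ?prime_gt1 // logn_gt0 mem_primes pp C0.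
Qed.

Definition lcmto n := \big[lcmn/1]_(i < n) i.+1.

Lemma lcmto_gt0 n : 0 < lcmto n.
Proof. by apply: (big_ind (fun x => 0 < x)) => // x y; rewrite lcmn_gt0 => -> ->. Qed.

Lemma dvdn_lcmto n m : 0 < m <= n -> m %| lcmto n.
Proof.
case: m => // m /andP[_ mn].
exact: (@biglcmn_sup _ (Ordinal mn) xpredT (fun i : 'I_n => i.+1)).
Qed.

(** For a prime power [p ^ e] in [(n, 2 n]], [p ^ (e - 1)] divides [lcmto n], and the missing [p]
    divides the binomial coefficient because the term of exponent [e] in Legendre's formula is
    positive. *)
Lemma lcmto_double n : lcmto n.*2 %| lcmto n * 'C(n.*2, n).
Proof.
apply/dvdn_biglcmP => -[i /= i2n] _; apply/dvdn_partP => // p pm.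
have pp : prime p by move: pm; rewrite mem_primes => /andP[].
have e0 : 0 < logn p i.+1 by rewrite logn_gt0.
rewrite p_part; set e := logn p i.+1 in e0 *.
have pe : p ^ e <= n.*2.
  by apply: leq_trans i2n; apply: dvdn_leq => //; exact: pfactor_dvdnn.
have [pn|pn] := leqP (p ^ e) n.
  by apply: dvdn_mulr; apply: dvdn_lcmto; rewrite pn expn_gt0 prime_gt0.
case: e e0 pe pn => // e _ pe pn; rewrite expnSr; apply: dvdn_mul.
  apply: dvdn_lcmto; rewrite expn_gt0 prime_gt0 //=.
  by have := prime_gt1 pp; move: pe; rewrite expnS; nia.
have : 0 < logn p 'C(n.*2, n).
  rewrite logn_central_bin // (bigD1_seq e.+1) ?iota_uniq //=; last first.
    rewrite mem_index_iota /= ltnS.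
    by apply: leq_trans pe; apply: ltnW; rewrite ltn_expl ?prime_gt1.
  rewrite (divn_small pn) subn0 ltn_addr // divn_gt0 // expn_gt0 prime_gt0 //.
by rewrite logn_gt0 mem_primes => /and3P[].
Qed.

Lemma bin_le_exp2 n m : 'C(n, m) <= 2 ^ n.
Proof.
have [mn|nm] := leqP m n; last by rewrite bin_small.
have -> : 2 ^ n = \sum_(i < n.+1) 'C(n, i).
  rewrite -[2]/(1 + 1) expnDn; apply: eq_bigr => i _.
  by rewrite !exp1n !muln1.
have h : m < n.+1 by [].
by rewrite (bigD1 (Ordinal h)) //= leq_addr.
Qed.

Lemma central_bin_le n : 'C(n.*2, n) <= 4 ^ n.
Proof.
by rewrite -[4]/(2 ^ 2) -expnM mul2n bin_le_exp2.
Qed.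

Lemma dvdn_lcmto_mono m n : m <= n -> lcmto m %| lcmto n.
Proof.
move=> mn; apply/dvdn_biglcmP => -[i /= im] _; apply: dvdn_lcmto => /=.
exact: leq_trans mn.
Qed.

Lemma lcmto_expn2_le k : lcmto (2 ^ k) <= 4 ^ (2 ^ k).
Proof.
elim: k => [|k IH]; first by rewrite /lcmto big_ord_recl big_ord0.
rewrite expnS mul2n.
apply: leq_trans (dvdn_leq _ (lcmto_double _)) _.
  by rewrite muln_gt0 lcmto_gt0 bin_gt0 -addnn leq_addr.
by rewrite -[in X in _ <= X]addnn expnD leq_mul // central_bin_le.
Qed.

(** Doubling gives [4 ^ m] for a power of two [m]; rounding [n] up to a power of two at most doubles
    it. *)
Lemma lcmto_le n : lcmto n <= 16 ^ n.
Proof.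
case: n => [|n]; first by rewrite /lcmto big_ord0.
have /andP[h1 h2] := @trunc_log_bounds 2 n.+1 isT isT.
apply: leq_trans (dvdn_leq (lcmto_gt0 _) (dvdn_lcmto_mono (ltnW h2))) _.
apply: leq_trans (lcmto_expn2_le _) _.
by rewrite -[16]/(4 ^ 2) -expnM leq_exp2l // expnS leq_mul2l.
Qed.

(** A weak Stirling bound: [n! 'C(2 n, n)] is the product of the [n] integers following [n]. It
    converts [(K n) ^ n] into [(4 K) ^ n n!] in the estimates of blocks. *)
Lemma expnn_le n : n ^ n <= 4 ^ n * n`!.
Proof.
apply: leq_trans (leq_mul (central_bin_le n) (leqnn _)).
rewrite bin_ffact ffact_prod -{1 2}[n]card_ord -prod_nat_const leq_prod // => i _.
have := ltn_ord i; rewrite card_ord; lia.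
Qed.

Lemma expn_le_exp2 n m : n ^ m <= m`! * 2 ^ m * 2 ^ n.
Proof.
rewrite -mulnA -expnD addnC.
apply: (@leq_trans ((n + m) ^_ m)); last by rewrite -bin_ffact mulnC leq_mul2l bin_le_exp2 orbT.
rewrite ffact_prod -[X in n ^ X]card_ord -prod_nat_const leq_prod // => i _.
have := ltn_ord i; lia.
Qed.

Local Open Scope classical_set_scope.
Local Open Scope ring_scope.

(** * Partial fractions with controlled denominators *)

Section PartialFractions.
Variables (R : archiRealFieldType) (n : nat).
Implicit Types (g : R -> R) (c : nat -> nat -> R) (x B : R).

Let L : R := (lcmto n)%:R.

Definition nonpole x := forall j, (j <= n)%N -> x + j%:R != 0.

Definition polar x : R := \prod_(j < n.+1) (x + j%:R).

Lemma natr_fact m : \prod_(0 <= i < m) i.+1%:R = m`!%:R :> R.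
Proof.
by elim: m => [|m IH]; rewrite ?big_nil // big_nat_recr //= IH factS natrM mulrC.
Qed.

Lemma prod_differences j : (j <= n)%N ->
  \prod_(i < n.+1 | i != j :> nat) (i%:R - j%:R) =
  (-1) ^+ j * (j`! * (n - j)`!)%:R :> R.
Proof.
move=> jn; rewrite -(big_mkord (fun i => i != j) (fun i => i%:R - j%:R : R)).
rewrite (@big_cat_nat _ _ _ j) //=; last by lia.
rewrite [X in _ * X]big_ltn_cond ?ltnS // eqxx /=.
rewrite natrM mulrA; congr (_ * _).
  rewrite big_nat_rev /= big_nat_cond.
  rewrite (eq_bigr (fun i => -1 * i.+1%:R)); last first.
    move=> i /andP[/andP[_ ij] _]; rewrite add0n natrB //; ring.
  rewrite (eq_bigl (fun i => (0 <= i < j)%N)); last by move=> i; lia.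
  rewrite -big_nat big_split /= prodr_const_nat subn0; congr (_ * _).
  exact: natr_fact.
have -> : n.+1 = (n - j + j.+1)%N by lia.
rewrite -{1}(add0n j.+1) big_addn addnK big_nat_cond.
rewrite (eq_bigr (fun i => i.+1%:R)); last first.
  by move=> i _; rewrite -natrB; [congr _%:R; lia | lia].
rewrite (eq_bigl (fun i => (0 <= i < n - j)%N)); last by move=> i; lia.
by rewrite -big_nat natr_fact.
Qed.

Definition simple_fraction B g := exists A : nat -> R,
  [/\ forall j, A j \is a Num.int, \sum_(j < n.+1) `|A j| <= B &
      forall x, nonpole x -> g x = \sum_(j < n.+1) A j / (x + j%:R)].

(** The residue at [- j] is [Q(- j)] over [+- j! (n - j)!], that is [+- 'C(n, j) Q(- j) / n!].
    Values divisible by [n!] make it integral, and the binomials sum to [2 ^ n]. *)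
Lemma poly_simple_fraction (Q : {poly R}) B : (size Q <= n.+1)%N ->
  (forall j, (j <= n)%N -> Q.[- j%:R] / n`!%:R \is a Num.int) ->
  (forall j, (j <= n)%N -> `|Q.[- j%:R]| <= B * n`!%:R) ->
  simple_fraction (2 ^+ n * B) (fun x => Q.[x] / polar x).
Proof.
move=> sQ Qi QB.
pose d (j : nat) : R := \prod_(i < n.+1 | i != j :> nat) (i%:R - j%:R).
pose A (j : nat) : R := if (j <= n)%N then Q.[- j%:R] / d j else 0.
have f0 k : k`!%:R != 0 :> R by rewrite pnatr_eq0 -lt0n fact_gt0.
have dE j : (j <= n)%N -> (d j)^-1 = (-1) ^+ j * 'C(n, j)%:R / n`!%:R.
  move=> jn; rewrite /d prod_differences // invfM invr_sign.
  rewrite -[RHS]mulrA; congr (_ * _).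
  by rewrite -[in RHS](bin_fact jn) [in RHS]natrM [in RHS]invfM mulrA mulfV ?mul1r // pnatr_eq0 -lt0n bin_gt0.
exists A; split.
- move=> j; rewrite /A; case: leqP => // jn; rewrite dE //.
  rewrite (_ : _ * _ = Q.[- j%:R] / n`!%:R * ((-1) ^+ j * 'C(n, j)%:R)); last by ring.
  by rewrite rpredM ?Qi // rpredM ?rpred_nat // rpredX // rpredN rpred1.
- apply: (@le_trans _ _ (\sum_(j < n.+1) 'C(n, j)%:R * B)).
    apply: ler_sum => -[j jn] _ /=; rewrite /A; rewrite ltnS in jn; rewrite jn dE //.
    rewrite normrM mulrC !normrM normrX normrN1 expr1n mul1r normfV !normr_nat.
    rewrite -mulrA; apply: ler_wpM2l; first exact: ler0n.
    by rewrite mulrC ler_pdivrMr ?ltr0n ?fact_gt0 ?QB.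
  rewrite -mulr_suml ler_wpM2r //.
    have := QB 0%N isT; have := normr_ge0 Q.[- 0%:R].
    have : 0 < n`!%:R :> R by rewrite ltr0n fact_gt0.
    nra.
  rewrite -natr_sum -[2]/(1 + 1)%:R -natrX expnDn ler_nat leq_sum // => i _.
  by rewrite !exp1n !muln1.
move=> x hx.
(* Lagrange interpolation: [P] and [Q] have degree at most [n] and agree at the [n + 1] points
   [- j]. *)
pose P : {poly R} := \sum_(j < n.+1) A j *: \prod_(i < n.+1 | i != j) ('X + (i%:R)%:P).
have sP : (size P <= n.+1)%N.
  apply: (leq_trans (size_sum _ _ _)); apply/bigmax_leqP => j _.
  apply: (leq_trans (size_scale_leq _ _)).
  apply: (leq_trans (size_poly_prod_leq _ _)).
  rewrite (eq_bigr (fun=> 2%N)); last by move=> i _; rewrite size_XaddC.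
  rewrite sum_nat_const cardC1 card_ord; lia.
have PE : P = Q.
  apply/eqP; rewrite -subr_eq0; apply/negPn/negP => nz.
  pose rs := [seq - (i : nat)%:R : R | i <- index_iota 0 n.+1].
  have urs : uniq rs by rewrite map_inj_uniq ?iota_uniq // => i j /oppr_inj/eqP; rewrite eqr_nat => /eqP.
  have rr : all (root (P - Q)) rs.
    apply/allP => _ /mapP[j jn ->]; rewrite mem_index_iota /= in jn.
    rewrite rootE hornerD hornerN /P horner_sum.
    rewrite (bigD1 (Ordinal jn)) //= [X in _ + X - _]big1 => [|i ij]; last first.
      rewrite hornerZ horner_prod (bigD1 (Ordinal jn)) 1?eq_sym //=.
      rewrite !hornerE /=. by rewrite addNr mulr0 mul0r.
    have jn1 : (j <= n)%N by rewrite -ltnS.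
    rewrite addr0 hornerZ horner_prod /A /= jn1.
    rewrite (eq_bigr (fun i : 'I_n.+1 => i%:R - j%:R)); last first.
      by move=> i _; rewrite !hornerE addrC.
    rewrite divfK ?subrr //.
    apply/prodf_neq0 => i ij; rewrite subr_eq0 eqr_nat.
    exact: ij.
  have := max_poly_roots nz rr urs; rewrite size_map size_iota subn0 => h.
  have := leq_trans h (size_polyD _ _); rewrite size_polyN leqNgt => /negP; apply.
  by rewrite ltnS geq_max sP sQ.
rewrite -PE horner_sum mulr_suml; apply: eq_bigr => j _.
rewrite hornerZ horner_prod -mulrA; congr (_ * _).
have -> : polar x = (x + j%:R) * \prod_(i < n.+1 | i != j) (x + i%:R) by rewrite /polar (bigD1 j).
rewrite invfM mulrC -mulrA.
rewrite [X in _ * (_ * X)](eq_bigr (fun i : 'I_n.+1 => x + i%:R)); last by move=> i _; rewrite !hornerE.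
rewrite mulVf ?mulr1 //; apply/prodf_neq0 => i _; apply: hx; by rewrite -ltnS.
Qed.

(* Orders are shifted by one: [c i j] multiplies [1 / (x + j) ^ (i + 1)]. *)
Definition pfeval s c x : R := \sum_(i < s) \sum_(j < n.+1) c i j / (x + j%:R) ^+ i.+1.

(** In a product of [s] simple fractions, each order lost below [s] costs one division by a
    difference of poles, hence one factor [lcm(1, ..., n)]. *)
Definition pfr s B g := exists c : nat -> nat -> R,
  [/\ forall i j, (i < s)%N -> L ^+ (s - i.+1) * c i j \is a Num.int,
      \sum_(i < s) \sum_(j < n.+1) `|c i j| <= B &
      forall x, nonpole x -> g x = pfeval s c x].

Lemma pfr_ext s B g h : (forall x, nonpole x -> g x = h x) -> pfr s B h -> pfr s B g.
Proof. by move=> e [c [h1 h2 h3]]; exists c; split=> // x hx; rewrite e // h3. Qed.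

Lemma pfr_le s B C g : B <= C -> pfr s B g -> pfr s C g.
Proof. by move=> e [c [h1 h2 h3]]; exists c; split=> //; exact: le_trans e. Qed.

Lemma pfr_add s B C g h : pfr s B g -> pfr s C h -> pfr s (B + C) (fun x => g x + h x).
Proof.
move=> [c [c1 c2 c3]] [d [d1 d2 d3]]; exists (fun i j => c i j + d i j); split.
- by move=> i j si; rewrite mulrDr rpredD ?c1 ?d1.
- apply: (le_trans _ (lerD c2 d2)); rewrite -big_split ler_sum // => i _.
  by rewrite -big_split ler_sum // => j _; apply: ler_normD.
- move=> x hx; rewrite c3 // d3 // /pfeval -big_split; apply: eq_bigr => i _.
  by rewrite -big_split; apply: eq_bigr => j _ /=; rewrite mulrDl.
Qed.

Lemma pfr_sum s (I : finType) (B : I -> R) (g : I -> R -> R) :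
  (forall i, pfr s (B i) (g i)) -> pfr s (\sum_i B i) (fun x => \sum_i g i x).
Proof.
move=> h; elim: (index_enum I) => [|i r IH].
  exists (fun _ _ => 0); split.
  - by move=> *; rewrite mulr0 rpred0.
  - by rewrite big_nil big1 // => i _; rewrite big1 // => j _; rewrite normr0.
  - move=> x _; rewrite big_nil /pfeval big1 // => i _.
    by rewrite big1 // => j _; rewrite mul0r.
rewrite big_cons; apply: pfr_ext (pfr_add (h i) IH) => x _.
by rewrite big_cons.
Qed.

Lemma pfr_elem s i j (a : R) : (i < s)%N -> (j <= n)%N ->
  L ^+ (s - i.+1) * a \is a Num.int ->
  pfr s `|a| (fun x => a / (x + j%:R) ^+ i.+1).
Proof.
move=> si jn ai; rewrite -ltnS in jn.
have E (F : nat -> nat -> R) : (forall i' j', ~~ ((i' == i) && (j' == j)) -> F i' j' = 0) ->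
    \sum_(i' < s) \sum_(j' < n.+1) F i' j' = F i j.
  move=> F0; rewrite (bigD1 (Ordinal si)) //= [X in _ + X]big1 => [|i' ii']; last first.
    rewrite big1 // => j' _; rewrite F0 // negb_and; apply/orP; left; move: ii'; rewrite -val_eqE; apply.
  rewrite addr0 (bigD1 (Ordinal jn)) //= big1 ?addr0 // => j' jj'.
  by rewrite F0 // negb_and; apply/orP; right; move: jj'; rewrite -val_eqE; apply.
exists (fun i' j' => if (i' == i) && (j' == j) then a else 0); split.
- by move=> i' j' _; case: ifP => [/andP[/eqP-> _]//|_]; rewrite mulr0 rpred0.
- rewrite (E (fun i' j' => `|if (i' == i) && (j' == j) then a else 0|)) ?eqxx //.
  by move=> i' j' /negbTE ->; rewrite normr0.
- move=> x _; rewrite /pfeval.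
  rewrite (E (fun i' j' => (if (i' == i) && (j' == j) then a else 0) / (x + j'%:R) ^+ i'.+1)) ?eqxx //.
  by move=> i' j' /negbTE ->; rewrite mul0r.
Qed.

Lemma lcmto_div_int j k : (j <= n)%N -> (k <= n)%N -> j != k ->
  L / (k%:R - j%:R) \is a Num.int.
Proof.
move=> jn kn jk.
have : exists2 m, (0 < m <= n)%N & (k%:R - j%:R = m%:R :> R) \/ (k%:R - j%:R = - m%:R :> R).
  move: jk; rewrite neq_ltn => /orP[jk|kj].
    by exists (k - j)%N; [lia | left; rewrite natrB // ltnW].
  by exists (j - k)%N; [lia | right; rewrite natrB ?opprB // ltnW].
case=> m mn h; have [d dE] := dvdnP (dvdn_lcmto mn).
have m0 : m%:R != 0 :> R by rewrite pnatr_eq0; lia.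
have Lm : L / m%:R \is a Num.int by rewrite /L dE natrM mulfK // rpred_nat.
by case: h => ->; rewrite ?invrN ?mulrN ?rpredN.
Qed.

(** For [j != k], [1 / ((x + j) (x + k))] is a difference of simple fractions over [k - j]; used
    repeatedly, it lowers the order at [- j] one unit at a time. Each division is paid by one [L]
    and, as [|k - j| >= 1], enlarges no coefficient, so the [i + 2] resulting terms give the
    bound. *)
Lemma pfr_elem_mul s i j k (a : R) : (i < s)%N -> (j <= n)%N -> (k <= n)%N ->
  L ^+ (s - i.+1) * a \is a Num.int ->
  pfr s.+1 (s.+1%:R * `|a|) (fun x => a / (x + j%:R) ^+ i.+1 / (x + k%:R)).
Proof.
move=> si jn kn ai.
have [<-|jk] := eqVneq j k.
  apply: (@pfr_le _ `|a|); first by rewrite ler_peMl // ler1n.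
  apply: pfr_ext (pfr_elem (i := i.+1) (j := j) (a := a) _ jn _).
  - by move=> x _; rewrite [in RHS]exprSr invfM mulrA.
  - by rewrite ltnS.
  - by rewrite subSS.
apply: (@pfr_le _ (i.+2%:R * `|a|)); first by rewrite ler_wpM2r // ler_nat; lia.
have Li := lcmto_div_int jn kn jk.
have kj0 : k%:R - j%:R != 0 :> R by rewrite subr_eq0 eqr_nat eq_sym.
have kj1 (b : R) : `|b / (k%:R - j%:R)| <= `|b|.
  rewrite normrM normfV ler_pdivrMr ?normr_gt0 // ler_peMr //.
  rewrite -[k%:R]/(k%:Z%:~R) -[j%:R]/(j%:Z%:~R) -rmorphB /= -intr_norm -[1]/(1%:~R) ler_int.
  by lia.
elim: i a si ai => [|i IH] a si ai.
  rewrite mulr_natl mulr2n.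
  apply: (@pfr_le _ (`|a / (k%:R - j%:R)| + `|- (a / (k%:R - j%:R))|)).
    by rewrite normrN lerD.
  have q : L ^+ s * (a / (k%:R - j%:R)) \is a Num.int.
    case: s si ai => // s _; rewrite subSS subn0 => ai.
    by rewrite exprSr mulrACA rpredM.
  apply: pfr_ext (pfr_add (pfr_elem (i := 0) (s := s.+1) (j := j) _ jn _)
    (pfr_elem (i := 0) (s := s.+1) (j := k) _ kn _)); rewrite ?subSS ?subn0 //; last first.
    by rewrite mulrN rpredN.
  move=> x hx; rewrite !expr1; field.
  by rewrite !hx // kj0.
pose b := a / (k%:R - j%:R).
rewrite -[i.+3%:R]natr1 mulrDl mul1r addrC.
have hb : L ^+ (s - i.+1) * b \is a Num.int.
  have -> : (s - i.+1 = (s - i.+2).+1)%N by lia.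
  by rewrite /b exprSr mulrACA rpredM.
apply: (@pfr_le _ (`|b| + i.+2%:R * `|- b|)).
  by rewrite normrN lerD ?kj1 // ler_wpM2l ?ler0n ?kj1.
have E1 : pfr s.+1 `|b| (fun x => b / (x + j%:R) ^+ i.+2).
  by apply: pfr_elem; rewrite ?subSS //; lia.
have E2 := IH (- b) _ _; apply: pfr_ext (pfr_add E1 (E2 _ _)); last 2 first.
- by lia.
- by rewrite mulrN rpredN.
- move=> x hx; rewrite /b [in X in _ = X + _]exprS [in LHS]exprS; field.
  by rewrite !hx // kj0 expf_neq0 // hx.
Qed.

Lemma pfr_mul s B C g h : 0 <= B -> pfr s B g -> simple_fraction C h ->
  pfr s.+1 (s.+1%:R * C * B) (fun x => g x * h x).
Proof.
move=> B0 [c [c1 c2 c3]] [A [A1 A2 A3]].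
apply: (@pfr_le _ (\sum_(i < s) \sum_(j < n.+1) \sum_(k < n.+1) s.+1%:R * `|c i j * A k|)).
  have C0 : 0 <= C by apply: le_trans A2; rewrite sumr_ge0.
  apply: (@le_trans _ _ (s.+1%:R * C * \sum_(i < s) \sum_(j < n.+1) `|c i j|)); last first.
    by rewrite ler_wpM2l // mulr_ge0.
  rewrite mulr_sumr ler_sum // => i _; rewrite mulr_sumr ler_sum // => j _.
  rewrite -mulr_sumr -mulrA ler_wpM2l //.
  under eq_bigr do rewrite normrM.
  by rewrite -mulr_sumr mulrC ler_wpM2r.
apply: (@pfr_ext _ _ _ (fun x => \sum_(i < s) \sum_(j < n.+1) \sum_(k < n.+1)
   (c i j * A k) / (x + j%:R) ^+ i.+1 / (x + k%:R))).
  move=> x hx; rewrite c3 // A3 // /pfeval mulr_suml; apply: eq_bigr => i _.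
  rewrite mulr_suml; apply: eq_bigr => j _; rewrite mulr_sumr; apply: eq_bigr => k _.
  by rewrite mulrA; congr (_ / _); rewrite mulrAC.
apply: pfr_sum => i; apply: pfr_sum => j; apply: pfr_sum => k.
have jn : (j <= n)%N by rewrite -ltnS.
have kn : (k <= n)%N by rewrite -ltnS.
by apply: pfr_elem_mul => //; rewrite mulrA rpredM ?c1.
Qed.

(** The factorial collects one factor per multiplication. It is harmless because the number of
    factors will be [b], fixed while [n] grows. *)
Lemma pfr_prod s (C : nat -> R) (g : nat -> R -> R) :
  (forall i, simple_fraction (C i) (g i)) ->
  pfr s.+1 (s.+1`!%:R * \prod_(i < s.+1) C i) (fun x => \prod_(i < s.+1) g i x).
Proof.
move=> h; have C0 i : 0 <= C i.
  by have [A [_ A2 _]] := h i; apply: le_trans A2; rewrite sumr_ge0.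
elim: s => [|s IH].
  have [A [A1 A2 A3]] := h 0; rewrite big_ord1 mul1r.
  exists (fun _ => A); split.
  - by move=> i j; case: i => // _; rewrite mul1r.
  - by rewrite big_ord1.
  - by move=> x hx; rewrite !big_ord1 A3 // /pfeval big_ord1; apply: eq_bigr => j _.
have D0 : 0 <= s.+1`!%:R * \prod_(i < s.+1) C i by rewrite mulr_ge0 // prodr_ge0.
apply: (@pfr_le _ (s.+2%:R * C s.+1 * (s.+1`!%:R * \prod_(i < s.+1) C i))).
  by rewrite [in X in _ <= X]big_ord_recr /= [s.+2`!]factS [in X in _ <= X]natrM le_eqVlt;
    apply/orP; left; apply/eqP; ring.
apply: pfr_ext (pfr_mul D0 IH (h s.+1)) => x _.
by rewrite big_ord_recr.
Qed.

Lemma nonpole_refl x : nonpole x -> nonpole (- n%:R - x).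
Proof.
move=> hx j jn; have := hx (n - j)%N (leq_subr _ _).
by rewrite natrB //; apply: contra => /eqP h; apply/eqP; lra.
Qed.

(* Averaging the coefficients with their images under [x -> - n - x] makes the
   symmetry visible without uniqueness of partial fractions; doubling [g]
   keeps the coefficients integral. *)
Lemma pfr_sym s B g (t : nat) : pfr s B g ->
  (forall x, nonpole x -> g (- n%:R - x) = (-1) ^+ t * g x) ->
  exists c : nat -> nat -> R,
  [/\ forall i j, (i < s)%N -> L ^+ (s - i.+1) * c i j \is a Num.int,
      \sum_(i < s) \sum_(j < n.+1) `|c i j| <= 2 * B,
      forall x, nonpole x -> 2 * g x = pfeval s c x &
      forall i, ~~ odd (t + i) -> \sum_(j < n.+1) c i j = 0].
Proof.
move=> [c [c1 c2 c3]] gs.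
have rv (F : nat -> R) : \sum_(j < n.+1) F (n - j)%N = \sum_(j < n.+1) F j.
  by rewrite [RHS](reindex_inj rev_ord_inj) /=; apply: eq_bigr => j _; rewrite subSS.
exists (fun i j => c i j + (-1) ^+ (t + i.+1) * c i (n - j)%N); split.
- move=> i j si; rewrite mulrDr rpredD ?c1 // mulrCA rpredM ?c1 //.
  by rewrite rpredX // rpredN rpred1.
- rewrite mulrDl mul1r; apply: (le_trans _ (lerD c2 c2)); rewrite -big_split ler_sum // => i _.
  rewrite -[X in _ <= _ + X](rv (fun j => `|c i j|)) -big_split ler_sum // => j _.
  by apply: (le_trans (ler_normD _ _)); rewrite normrM normrX normrN1 expr1n mul1r.
- move=> x hx; rewrite mulrDl mul1r.
  have sg : (-1) ^+ t * (-1) ^+ t = 1 :> R by rewrite -exprD addnn -signr_odd odd_double.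
  have gx : g x = (-1) ^+ t * g (- n%:R - x) by rewrite gs // mulrA sg mul1r.
  rewrite {2}gx !c3 //; last exact: nonpole_refl.
  rewrite /pfeval mulr_sumr -big_split; apply: eq_bigr => i _.
  have /= <- := rv (fun j => c i j / (- n%:R - x + j%:R) ^+ i.+1).
  rewrite mulr_sumr -big_split; apply: eq_bigr => j _ /=.
  rewrite [RHS]mulrDl; congr (_ + _).
  have -> : - n%:R - x + (n - j)%:R = - (x + j%:R).
    by rewrite natrB -1?ltnS //; ring.
  rewrite [(- (_ + _)) ^+ _]exprNn invfM invr_sign exprD -!mulrA; congr (_ * _).
  by rewrite mulrCA.
- move=> i it; rewrite big_split /= -mulr_sumr (rv (fun j => c i j)).
  by rewrite addnS -signr_odd /= it expr1 mulN1r subrr.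
Qed.

End PartialFractions.

(** * A linear independence criterion *)

Section Criterion.
Variable R : archiRealFieldType.

(** Pigeonhole: the fractional parts of [t theta], [0 <= t <= N ^ k], fall into [N ^ k] boxes of
    side [1 / N]. *)
Lemma dirichlet_approximation (k N : nat) (theta : 'I_k -> R) : (0 < N)%N ->
  exists (q : nat) (p : 'I_k -> int), (0 < q <= N ^ k)%N /\
    forall j, `|q%:R * theta j - (p j)%:~R| <= N%:R^-1.
Proof.
move=> N0; have Nr : 0 < N%:R :> R by rewrite ltr0n.
pose fr (y : R) := y - (Num.floor y)%:~R.
have fr0 y : 0 <= fr y by rewrite subr_ge0 floor_le.
have fr1 y : fr y < 1.
  by rewrite ltrBlDl; have := floorD1_gt y; rewrite rmorphD /= addrC.
pose cd (y : R) := Num.truncn (N%:R * fr y).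
have cdN y : (cd y < N)%N.
  by rewrite truncn_lt_nat ?mulr_ge0 // gtr_pMr.
pose F (t : 'I_(N ^ k).+1) : {ffun 'I_k -> 'I_N} :=
  [ffun j => Ordinal (cdN (t%:R * theta j))].
have /injectivePn [t1 [t2 t12 Ft]] : ~~ injectiveb F.
  apply/negP => /injectiveP /leq_card; rewrite card_ord card_ffun !card_ord; lia.
wlog lt12 : t1 t2 t12 Ft / (t1 < t2)%N.
  move=> h; move: (t12); rewrite -val_eqE neq_ltn => /orP[l|l]; first exact: (h t1 t2).
  by apply: (h t2 t1) => //; rewrite eq_sym.
exists (t2 - t1)%N, (fun j => Num.floor (t2%:R * theta j) - Num.floor (t1%:R * theta j)); split.
  by rewrite subn_gt0 lt12 /= (leq_trans (leq_subr _ _)) // -ltnS.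
move=> j; have := congr1 (fun f : {ffun 'I_k -> 'I_N} => val (f j)) Ft; rewrite !ffunE /= => E.
have := truncn_itv (mulr_ge0 (ltW Nr) (fr0 (t1%:R * theta j))).
have := truncn_itv (mulr_ge0 (ltW Nr) (fr0 (t2%:R * theta j))).
rewrite -/(cd (t1%:R * theta j)) -/(cd (t2%:R * theta j)) E -natr1.
move=> /andP[a1 a2] /andP[b1 b2].
rewrite natrB 1?ltnW // mulrBl rmorphB /=.
have -> : t2%:R * theta j - t1%:R * theta j -
   ((Num.floor (t2%:R * theta j))%:~R - (Num.floor (t1%:R * theta j))%:~R) =
   fr (t2%:R * theta j) - fr (t1%:R * theta j) by rewrite /fr; ring.
rewrite -(ler_pM2l Nr) divff ?gt_eqF // -{1}[N%:R](gtr0_norm Nr) -normrM mulrBr ler_norml.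
by lra.
Qed.

Lemma exprn_unbounded (X B : R) : 1 < X -> exists n, B <= X ^+ n.
Proof.
move=> X1; have d0 : 0 < X - 1 by rewrite subr_gt0.
have bern n : 1 + n%:R * (X - 1) <= X ^+ n.
  elim: n => [|n IH]; first by rewrite mul0r addr0.
  rewrite exprS -natr1; have : 0 <= n%:R * (X - 1) ^+ 2 :> R by rewrite mulr_ge0 ?sqr_ge0.
  have : X * (1 + n%:R * (X - 1)) <= X * X ^+ n by rewrite ler_wpM2l //; lra.
  move: (X ^+ n) IH (n%:R : R) => Y IH m; lra.
have := archi_boundP (divr_ge0 (normr_ge0 B) (ltW d0)).
set n := Num.bound _; rewrite ltr_pdivrMr // => h.
exists n; apply: le_trans (bern n); have := ler_norm B; lra.
Qed.

(* Nesterenko's criterion in a weak form. Dirichlet's theorem gives a point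
   [p] of the lattice close to the line spanned by [theta]; if [n] is adapted
   to its size, the value at [p] of the [n]-th form is an integer strictly
   between [0] and [1] in absolute value. *)
Lemma nesterenko_criterion (k : nat) (theta : 'I_k -> R) (X : R) (u v A n0 : nat) :
  1 < X -> (0 < k)%N -> ((u + v + 1) * k <= A)%N ->
  ~ (forall n, (n0 <= n)%N -> exists l : 'I_k -> int,
      (forall j, `|(l j)%:~R| <= X ^+ (u * n)) /\
      X ^- ((A + v) * n) <= `|\sum_j (l j)%:~R * theta j| <= X ^- (A * n)).
Proof.
move=> X1 k0 hA H.
have X0 : 0 < X by lra.
have XE n : 0 < X ^+ n by rewrite exprn_gt0.
have [n2 hn2] := exprn_unbounded (4 * k%:R * X ^+ (A + u + v + 1) + 1) X1.
(* From [n1] on, [X ^ n] exceeds the constant [4 k X ^ (A + u + v + 1)]; [N] is chosen so that the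
   approximation error is already small enough at [n = n1]. *)
pose n1 := maxn n0 n2.
pose N := (Num.truncn (k%:R * X ^+ ((u + A + v) * n1))).+1.
have NE : k%:R * X ^+ ((u + A + v) * n1) < N%:R.
  by have /andP[] := truncn_itv (mulr_ge0 (ler0n R k) (ltW (XE ((u + A + v) * n1)))).
have Nr : 0 < N%:R :> R by rewrite ltr0n.
have [q [p [/andP[q0 qN] hp]]] := @dirichlet_approximation k N theta isT.
have qr : 1 <= q%:R :> R by rewrite ler1n.
have A0 : (0 < A)%N by nia.
have exn : exists n, (n1 <= n)%N && (2 * q%:R <= X ^+ (A * n)).
  have [m hm] := exprn_unbounded (2 * q%:R) X1.
  exists (maxn n1 m); rewrite leq_maxl /=; apply: le_trans hm _.
  rewrite ler_weXn2l //; [exact: ltW|nia].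
(* The least [n] that makes [q |Lam| <= 1 / 2]. If [n > n1], minimality gives
   [X ^ (A (n - 1)) < 2 q], so [q] is not too small for [n]. *)
case: (ex_minnP exn) => n /andP[n1n hn] nmin.
have [l [l1 /andP[L1 L2]]] := H n ltac:(lia).
set Lam := \sum_j _ in L1 L2.
pose Z : int := \sum_j l j * p j.
pose err : R := \sum_j (l j)%:~R * (q%:R * theta j - (p j)%:~R).
have ZE : Z%:~R = q%:R * Lam - err :> R.
  rewrite /Z /err /Lam rmorph_sum mulr_sumr -sumrB; apply: eq_bigr => j _.
  by rewrite rmorphM /=; ring.
have errB : `|err| <= k%:R * X ^+ (u * n) / N%:R.
  apply: (le_trans (ler_norm_sum _ _ _)).
  apply: (@le_trans _ _ (\sum_(j < k) X ^+ (u * n) / N%:R)).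
    by apply: ler_sum => j _; rewrite normrM ler_pM.
  by rewrite sumr_const card_ord -[X in X <= _]mulr_natl mulrA.
have qL : q%:R * `|Lam| <= 1 / 2.
  apply: (@le_trans _ _ (q%:R * X ^- (A * n))); first by rewrite ler_wpM2l.
  by rewrite ler_pdivrMr //; lra.
have small : `|err| < q%:R * `|Lam|.
  apply: (le_lt_trans errB).
  apply: (@lt_le_trans _ _ (q%:R * X ^- ((A + v) * n))); last by rewrite ler_wpM2l.
  rewrite ltr_pdivrMr // mulrAC ltr_pdivlMr //.
  rewrite -mulrA -exprD -mulnDl addnA.
  have [n1E|n1n'] := eqVneq n n1.
    rewrite n1E; apply: (lt_le_trans NE); rewrite ler_peMl //.
  have n1n2 : (n1 < n)%N by rewrite ltn_neqAle eq_sym n1n' n1n.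
  have n_gt0 : (0 < n)%N by apply: leq_ltn_trans n1n2.
  have : ~~ ((n1 <= n.-1)%N && (2 * q%:R <= X ^+ (A * n.-1))).
    by apply/negP => /nmin; rewrite leqNgt prednK ?leqnn.
  rewrite -[X in (X && _)]ltnS prednK // n1n2 /=.
  rewrite -ltNge => qlow.
  (* Extraction of a [k]-th root from [X ^ (A (n - 1)) < 2 q <= 2 N ^ k], by [A >= (u + v + 1) k].
     The unit added to [u + v] leaves a spare [X ^ n], which absorbs the constants. *)
  have NX : X ^+ ((u + v + 1) * n.-1) < 2 * N%:R.
    rewrite ltNge; apply/negP => NX.
    have : (2 * N%:R) ^+ k <= X ^+ (A * n.-1).
      apply: (@le_trans _ _ (X ^+ ((u + v + 1) * n.-1 * k))).
        by rewrite exprM lerXn2r ?nnegrE //; rewrite ?mulr_ge0 // ltW.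
      by rewrite ler_weXn2l // ?(ltW X1) // mulnAC leq_mul2r hA orbT.
    move/le_lt_trans/(_ qlow); rewrite exprMn -[N%:R ^+ k]natrX.
    apply/negP; rewrite -leNgt.
    apply: ler_pM => //; [|by rewrite ler_nat].
    by rewrite -[X in X <= _]expr1 ler_weXn2l ?ler1n.
  pose Y := X ^+ (A + u + v + 1).
  have e1 : X ^+ ((u + A + v) * n) * X ^+ n =
      Y * X ^+ (A * n.-1) * X ^+ ((u + v + 1) * n.-1).
    rewrite -!exprD; congr (X ^+ _).
    by rewrite -[in LHS](prednK n_gt0); ring.
  have bE : 4 * k%:R * Y + 1 <= X ^+ n.
    by apply: le_trans hn2 _; rewrite ler_weXn2l ?(ltW X1) // (leq_trans _ n1n) // leq_maxr.
  have cd : X ^+ (A * n.-1) * X ^+ ((u + v + 1) * n.-1) <= 4 * (q%:R * N%:R).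
    apply: (@le_trans _ _ ((2 * q%:R) * (2 * N%:R))); last by lra.
    by rewrite ler_pM // ltW.
  rewrite -(ltr_pM2r (XE n)) -mulrA e1 -mulrA.
  apply: (@le_lt_trans _ _ (k%:R * (Y * (4 * (q%:R * N%:R))))).
    by rewrite !ler_wpM2l // ltW // XE.
  rewrite [X in X < _](_ : _ = q%:R * N%:R * (4 * k%:R * Y)); last by ring.
  by rewrite ltr_pM2l ?mulr_gt0 //; lra.
have : `|Z%:~R : R| < 1.
  rewrite ZE; apply: (le_lt_trans (ler_normB _ _)).
  rewrite normrM normr_nat; lra.
rewrite -intr_norm -[1]/(1%:~R) ltr_int => Z1.
have Z0 : Z = 0 by move: (Z) Z1; clear; lia.
have : `|q%:R * Lam| = `|err| by rewrite -[q%:R * Lam](subrK err) -ZE Z0 add0r.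
rewrite normrM normr_nat => E; move: small; rewrite E ltxx //.
Qed.

End Criterion.

(** * The rational function *)

Lemma prodrN_ord (R : comPzRingType) n (F : 'I_n -> R) :
  \prod_(l < n) - F l = (-1) ^+ n * \prod_(l < n) F l.
Proof. by rewrite prodrN card_ord. Qed.

Definition rising (z : int) (n : nat) : int := \prod_(l < n) (z + l%:Z).

(** Up to sign, [n] consecutive integers multiply to 0 or to [n!] times a binomial coefficient. *)
Lemma dvdz_fact_rising z n : (n`!%:Z %| rising z n)%Z.
Proof.
have nat_case (w : nat) : (n`!%:Z %| \prod_(l < n) (w%:Z - l%:Z))%Z.
  have [wn|nw] := ltnP w n.
    by rewrite (bigD1 (Ordinal wn)) //= subrr mul0r dvdz0.
  rewrite (eq_bigr (fun l : 'I_n => (w - l)%N%:Z)) => [|l _]; last first.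
    by rewrite -subzn // ltnW // (leq_trans (ltn_ord l)).
  have -> : \prod_(l < n) (w - l)%N%:Z = (w ^_ n)%:Z.
    by rewrite ffact_prod; elim/big_rec2: _ => // l x y _ ->; rewrite PoszM.
  by rewrite -bin_ffact PoszM dvdz_mull.
have [z0|z0] := leP 0 z.
  have -> : rising z n = \prod_(l < n) ((`|z| + n.-1)%N%:Z - l%:Z).
    rewrite /rising [LHS](reindex_inj rev_ord_inj) /=; apply: eq_bigr => l _.
    have := ltn_ord l; lia.
  exact: nat_case.
have -> : rising z n = (-1) ^+ n * \prod_(l < n) (`|z|%N%:Z - l%:Z).
  rewrite /rising -prodrN_ord; apply: eq_bigr => l _; lia.
by rewrite dvdz_mull.
Qed.

Lemma fact_le_rising z n : rising z n != 0 -> (n`! <= `|rising z n|)%N.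
Proof.
move=> h; apply: dvdn_leq; first by rewrite absz_gt0.
by have := dvdz_fact_rising z n; rewrite dvdzE.
Qed.

Lemma rising_le z n (M : nat) : (`|z| + n <= M)%N -> (`|rising z n| <= M ^ n)%N.
Proof.
move=> h; have <- : (\prod_(l < n) M = M ^ n)%N by rewrite prod_nat_const card_ord.
rewrite /rising.
elim/big_ind2: _ => // [a x b y ax by_|l _]; first by rewrite abszM leq_mul.
have := ltn_ord l; lia.
Qed.

Section RationalFunction.
Variables (R : archiRealFieldType) (n q k c : nat).

(* The start [z] encodes the zeros [m / q] with [- m] in [z, z + n). The blocks
   cover [1, c], [c, c + k n), then [c + k n + 1, c + 4 k n] and the negative
   grid points [- q n, - 1]; the only gap between [1] and [c + 4 k n] is
   [c + k n]. *)
Definition half_starts : seq int :=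
  - n%:Z :: [seq - (c.-1 + l * n + n)%N%:Z | l <- iota 0 k] ++
    [seq - (c + l * n + n)%N%:Z | l <- iota k (3 * k)] ++
    [seq (l * n).+1%:Z | l <- iota 0 q].

(** Under [x -> - n - x] the factor [q x + z + l] becomes [- (q x + q n - z - l)]; the smallest of
    these shifts, at [l = n - 1], starts the reflected block. *)
Definition refl_start (z : int) : int := (q * n)%N%:Z - z - n%:Z + 1.

Definition starts := half_starts ++ map refl_start half_starts.

Definition block (z : int) (x : R) : R := \prod_(l < n) (q%:R * x + (z + l%:Z)%:~R).

(** Padding by the constant [n!] provides exactly one numerator for each of the [b] factors
    [1 / polar], and all numerators take values divisible by [n!] at the poles. *)
Definition Qpoly (i : nat) : {poly R} :=
  if (i < size starts)%N then \prod_(l < n) (q%:R *: 'X + ((nth 0 starts i + l%:Z)%:~R)%:P)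
  else (n`!%:R)%:P.

Definition Rfun (b : nat) (x : R) : R := \prod_(i < b) ((Qpoly i).[x] / polar n x).

Hypotheses (n0 : (0 < n)%N) (c0 : (0 < c)%N) (cq : (c <= q)%N) (qk : (q <= k)%N) (qn : (q <= n)%N).

Lemma half_startsP z : reflect
  [\/ z = - n%:Z,
      exists2 l, (l < k)%N & z = - (c.-1 + l * n + n)%N%:Z,
      exists2 l, (k <= l < 4 * k)%N & z = - (c + l * n + n)%N%:Z |
      exists2 l, (l < q)%N & z = (l * n).+1%:Z] (z \in half_starts).
Proof.
apply: (iffP idP) => [|h].
  rewrite /half_starts in_cons !mem_cat => /or4P[/eqP->|/mapP[l]|/mapP[l]|/mapP[l]].
  - by constructor 1.
  - by rewrite mem_iota => h ->; constructor 2; exists l => //; lia.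
  - by rewrite mem_iota => h ->; constructor 3; exists l => //; lia.
  - by rewrite mem_iota => h ->; constructor 4; exists l => //; lia.
rewrite /half_starts in_cons !mem_cat; case: h => [->|[l h ->]|[l h ->]|[l h ->]].
- by rewrite eqxx.
- by apply/or4P; constructor 2; apply/mapP; exists l; rewrite ?mem_iota.
- by apply/or4P; constructor 3; apply/mapP; exists l; rewrite ?mem_iota; lia.
- by apply/or4P; constructor 4; apply/mapP; exists l; rewrite ?mem_iota.
Qed.

Lemma size_starts : size starts = (2 * (1 + 4 * k + q))%N.
Proof. by rewrite size_cat size_map /= !size_cat !size_map !size_iota; lia. Qed.

(** Origin of the exponent [12 k] in the later bounds. *)
Lemma size_starts_le : (size starts <= 12 * k)%N.
Proof. rewrite size_starts; lia. Qed.

Lemma starts_le z : z \in starts -> (`|z| <= 6 * k * n)%N.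
Proof.
have kn : (q * n <= k * n)%N by rewrite leq_mul2r qk orbT.
have half w : w \in half_starts -> (`|w| <= 5 * k * n)%N /\ (`|refl_start w| <= 6 * k * n)%N.
  rewrite /refl_start => /half_startsP[->|[l h ->]|[l /andP[_ h] ->]|[l h ->]].
  - split; nia.
  - have : (l.+1 * n <= k * n)%N by rewrite leq_mul2r h orbT.
    split; nia.
  - have : (l.+1 * n <= 4 * k * n)%N by rewrite leq_mul2r h orbT.
    split; nia.
  - have : (l.+1 * n <= q * n)%N by rewrite leq_mul2r h orbT.
    split; nia.
rewrite mem_cat => /orP[/half[h _]|/mapP[w /half[_ h] ->]] //; nia.
Qed.

Lemma block_grid z (m : int) : (0 < q)%N ->
  block z (m%:~R / q%:R) = (rising (m + z) n)%:~R.
Proof.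
move=> q0; rewrite /block /rising rmorph_prod; apply: eq_bigr => l _ /=.
by rewrite mulrC divfK ?pnatr_eq0 -?lt0n // -rmorphD /= addrA.
Qed.

Lemma block_refl z x : block z (- n%:R - x) = (-1) ^+ n * block (refl_start z) x.
Proof.
rewrite /block -prodrN_ord [LHS](reindex_inj rev_ord_inj) /=; apply: eq_bigr => l _.
have -> : (z + (n - l.+1)%N = z + n%:Z - 1 - l%:Z)%Z by have := ltn_ord l; lia.
rewrite /refl_start !rmorphD !rmorphN /= -!pmulrn natrM; ring.
Qed.

Lemma RfunE b x : (size starts <= b)%N ->
  Rfun b x = (\prod_(z <- starts) block z x) * n`!%:R ^+ (b - size starts) / polar n x ^+ b.
Proof.
move=> sb; rewrite /Rfun big_split /= prodr_const card_ord exprVn; congr (_ / _).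
rewrite -(big_mkord xpredT (fun i => (Qpoly i).[x])) (@big_cat_nat _ _ _ (size starts)) //=.
congr (_ * _).
  rewrite [RHS](big_nth 0) big_nat [RHS]big_nat; apply: eq_bigr => i /= isz.
  rewrite /Qpoly isz horner_prod; apply: eq_bigr => l _.
  by rewrite !hornerE.
rewrite big_nat (eq_bigr (fun=> n`!%:R)) => [|i /andP[h _]].
  by rewrite -big_nat prodr_const_nat.
by rewrite /Qpoly ltnNge h hornerC.
Qed.

(** The reflection exchanges the two halves of [starts], and each pair of blocks produces the sign
    [(-1) ^ n] twice. *)
Lemma prod_block_refl x :
  \prod_(z <- starts) block z (- n%:R - x) = \prod_(z <- starts) block z x.
Proof.
rewrite /starts; move: half_starts => s; rewrite !big_cat !big_map.
under eq_bigr do rewrite block_refl.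
under [X in _ * X = _]eq_bigr => z _.
  rewrite block_refl (_ : refl_start (refl_start z) = z); last by rewrite /refl_start; lia.
  over.
rewrite !big_split /= mulrACA -[X in X * _]big_split /=.
rewrite [X in X * _]big1 ?mul1r => [|z _]; last by rewrite -exprD addnn -signr_odd odd_double.
by rewrite mulrC.
Qed.

Lemma polar_refl (x : R) : polar n (- n%:R - x) = (-1) ^+ n.+1 * polar n x.
Proof.
rewrite /polar -prodrN_ord [LHS](reindex_inj rev_ord_inj) /=; apply: eq_bigr => l _.
rewrite subSS natrB; last by rewrite -ltnS.
by ring.
Qed.

Lemma Rfun_refl b x : (size starts <= b)%N ->
  Rfun b (- n%:R - x) = (-1) ^+ (n.+1 * b) * Rfun b x.
Proof.
move=> sb; rewrite !RfunE // prod_block_refl polar_refl exprMn invfM -exprM invr_sign; ring.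
Qed.

Lemma Rfun_pfr b : (0 < b)%N -> (size starts <= b)%N ->
  pfr n b (b`!%:R * (2 ^+ (n * b) * (32 * k%:R) ^+ (n * (12 * k)))) (Rfun b).
Proof.
move=> b0 sb; have k1 : 1 <= 32 * k%:R :> R by rewrite -natrM ler1n; lia.
have k0 : 0 <= 32 * k%:R :> R by apply: le_trans k1.
(* At [- j] the factors of a block are integers of size at most [6 k n + k n + n <= 8 k n], and
   [(8 k n) ^ n <= (32 k) ^ n n!]. *)
pose C (i : nat) : R := if (i < size starts)%N then (32 * k%:R) ^+ n else 1.
have f0 : 0 < n`!%:R :> R by rewrite ltr0n fact_gt0.
have nn : n%:R ^+ n <= 4 ^+ n * n`!%:R :> R.
  by rewrite -!natrX -natrM ler_nat expnn_le.
have S i : simple_fraction n (2 ^+ n * C i) (fun x => (Qpoly i).[x] / polar n x).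
  have val j : (i < size starts)%N ->
      (Qpoly i).[- j%:R] = (rising (nth 0 starts i - (q * j)%N%:Z) n)%:~R.
    move=> isz; rewrite /Qpoly isz horner_prod /rising rmorph_prod; apply: eq_bigr => l _.
    rewrite !hornerE !(rmorphD, rmorphN) /= -!pmulrn natrM; ring.
  apply: poly_simple_fraction.
  - rewrite /Qpoly; case: ifP => _; last by apply: (leq_trans (size_polyC_leq1 _)).
    apply: (leq_trans (size_poly_prod_leq _ _)).
    rewrite card_ord; apply: (@leq_trans ((\sum_(l < n) 2).+1 - n)); last first.
      by rewrite sum_nat_const card_ord; lia.
    rewrite leq_sub2r // ltnS leq_sum // => l _.
    apply: (leq_trans (size_polyD _ _)); rewrite geq_max.
    rewrite (leq_trans (size_scale_leq _ _)) ?size_polyX //=.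
    by rewrite (leq_trans (size_polyC_leq1 _)).
  - move=> j jn; have [isz|isz] := ltnP i (size starts).
      rewrite val //; have /dvdzP[w ->] := dvdz_fact_rising (nth 0 starts i - (q * j)%N%:Z) n.
      by rewrite rmorphM /= mulfK ?gt_eqF // intr_int.
    by rewrite /Qpoly ltnNge isz hornerC divff ?gt_eqF // rpred1.
  - move=> j jn; rewrite /C; have [isz|isz] := ltnP i (size starts); last first.
      by rewrite /Qpoly ltnNge isz hornerC mul1r ger0_norm // ltW.
    rewrite val // -intr_norm.
    have : (`|rising (nth 0 starts i - (q * j)%N%:Z)%R n| <= (8 * k * n) ^ n)%N.
      apply: rising_le; have := starts_le (mem_nth 0 isz).
      have : (q * j <= k * n)%N by rewrite leq_mul.
      have : (n <= k * n)%N by rewrite leq_pmull //; lia.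
      move: (nth 0 starts i) (q * j)%N => w v h1 h2 h3; lia.
    rewrite -(ler_nat R) natr_absz => /le_trans -> //.
    rewrite natrX natrM exprMn natrM.
    have -> : (32 * k%:R) ^+ n = (8%:R * k%:R) ^+ n * 4 ^+ n :> R by rewrite -exprMn; congr (_ ^+ _); ring.
    by rewrite -mulrA ler_wpM2l ?exprn_ge0 ?mulr_ge0.
case: b b0 sb => // b _ sb.
apply: pfr_le (pfr_prod b S); rewrite ler_wpM2l //.
rewrite big_split /= prodr_const card_ord -exprM ler_wpM2l ?exprn_ge0 //.
rewrite -(big_mkord xpredT C) (@big_cat_nat _ _ _ (size starts)) //=.
rewrite [X in _ * X]big_nat [X in _ * X]big1 => [|i /andP[h _]]; last by rewrite /C ltnNge h.
rewrite mulr1 big_nat (eq_bigr (fun=> (32 * k%:R) ^+ n)) => [|i /andP[_ h]]; last by rewrite /C h.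
rewrite -big_nat prodr_const_nat subn0 -exprM ler_weXn2l // leq_mul2l size_starts_le orbT //.
Qed.

Lemma Rfun_eq0 b x z (l : nat) : (size starts <= b)%N -> z \in starts -> (l < n)%N ->
  q%:R * x + (z + l%:Z)%:~R = 0 -> Rfun b x = 0.
Proof.
move=> sb zs ln h; rewrite RfunE // (perm_big _ (perm_to_rem zs)) big_cons.
by rewrite {1}/block (bigD1 (Ordinal ln)) //= h !mul0r.
Qed.

Lemma half_starts_sub z : z \in half_starts -> z \in starts.
Proof. by rewrite mem_cat => ->. Qed.

Lemma Rfun_pos_zero b m : (size starts <= b)%N -> (0 < m <= c + 4 * k * n)%N ->
  m <> (c + k * n)%N -> Rfun b (m%:R / q%:R) = 0.
Proof.
move=> sb /andP[m0 mle] mne.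
have q0 : q%:R != 0 :> R by rewrite pnatr_eq0; lia.
have mE : q%:R * (m%:R / q%:R) = m%:Z%:~R :> R by rewrite mulrC divfK.
suff [z zs [l ln e]] : exists2 z, z \in half_starts & exists2 l, (l < n)%N & m%:Z + z + l%:Z = 0.
  apply: (Rfun_eq0 sb (half_starts_sub zs) ln).
  by rewrite mE -rmorphD /= -[0]/(0%:~R); congr (_%:~R); rewrite addrA.
have [mc|cm] := ltnP m c.
  exists (- n%:Z); first by apply/half_startsP; constructor 1.
  by exists (n - m)%N; lia.
have [mlt|mgt] := ltnP m (c + k * n).
  pose l := ((m - c) %/ n)%N; pose r := ((m - c) %% n)%N.
  have rn : (r < n)%N by rewrite ltn_pmod.
  have E : (m = c + l * n + r)%N by rewrite -addnA -divn_eq; lia.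
  exists (- (c.-1 + l * n + n)%N%:Z); last by exists (n - 1 - r)%N; lia.
  apply/half_startsP; constructor 2; exists l => //.
  by rewrite ltn_divLR //; lia.
pose l := ((m - c - 1) %/ n)%N; pose r := ((m - c - 1) %% n)%N.
have rn : (r < n)%N by rewrite ltn_pmod.
have E : (m = c + 1 + l * n + r)%N by rewrite -addnA -divn_eq; lia.
exists (- (c + l * n + n)%N%:Z); last by exists (n - 1 - r)%N; lia.
apply/half_startsP; constructor 3; exists l => //.
by rewrite leq_divRL // ltn_divLR //; lia.
Qed.

Lemma Rfun_neg_zero b m : (size starts <= b)%N -> (0 < m <= q * n)%N ->
  Rfun b (- (m%:R / q%:R)) = 0.
Proof.
move=> sb /andP[m0 mle].
have q0 : q%:R != 0 :> R by rewrite pnatr_eq0; lia.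
pose l := (m.-1 %/ n)%N; pose r := (m.-1 %% n)%N.
have rn : (r < n)%N by rewrite ltn_pmod.
have E : (m = 1 + l * n + r)%N by rewrite -addnA -divn_eq; lia.
apply: (@Rfun_eq0 b _ (l * n).+1%:Z r sb _ rn).
  apply: half_starts_sub; apply/half_startsP; constructor 4; exists l => //.
  by rewrite ltn_divLR //; lia.
rewrite mulrN mulrC divfK // -[m%:R]/(m%:Z%:~R) -rmorphN -rmorphD /= -[0]/(0%:~R).
by congr (_%:~R); lia.
Qed.

Lemma rising_neq0 z m : (forall l, (l < n)%N -> m + z + l%:Z <> 0) -> rising (m + z) n != 0.
Proof. by move=> h; apply/prodf_neq0 => l _; apply/eqP; apply: h. Qed.

(** The original blocks skip [c + k n], and the reflected ones vanish only at nonpositive grid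
    points. *)
Lemma main_point_neq0 z : z \in starts -> rising ((c + k * n)%N%:Z + z) n != 0.
Proof.
move=> zs; apply: rising_neq0 => l ln.
have kn : (n <= k * n)%N by rewrite leq_pmull //; lia.
move: zs; rewrite mem_cat => /orP[/half_startsP|/mapP[w /half_startsP h ->]].
  case=> [->|[j h ->]|[j /andP[h _] ->]|[j h ->]].
  - lia.
  - have : (j.+1 * n <= k * n)%N by rewrite leq_mul2r h orbT.
    lia.
  - have : (k * n <= j * n)%N by rewrite leq_mul2r h orbT.
    lia.
  - lia.
rewrite /refl_start; case: h => [->|[j h ->]|[j /andP[h _] ->]|[j h ->]]; try lia.
have : (j.+1 * n <= q * n)%N by rewrite leq_mul2r h orbT.
lia.
Qed.

End RationalFunction.

(** [64 ^ (12 k)] is already [2 ^ (72 k)]. The two orders in excess of [12 k] yield the decay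
    [1 / m ^ 2] of the tail. *)
Lemma exponent_ge k b : (0 < k)%N -> (2 * (64 * k) ^ (12 * k) <= 2 ^ b)%N ->
  (12 * k + 2 <= b)%N.
Proof.
move=> k0 hb; have h : (2 * 2 ^ (6 * (12 * k)) <= 2 ^ b)%N.
  by apply: leq_trans hb; rewrite leq_mul2l /= expnM leq_exp2r; lia.
by move: h; rewrite -expnS leq_exp2l //; lia.
Qed.

(** * Size of the rational function at the grid points *)

Section Bounds.
Variables (R : archiRealFieldType) (n q k c r b : nat).
Hypotheses (n0 : (0 < n)%N) (c0 : (0 < c)%N) (cq : (c <= q)%N) (qk : (q <= k)%N) (qn : (q <= n)%N).
Hypotheses (krq : k = (r * q)%N) (r2 : (2 <= r)%N) (hb : (2 * (64 * k) ^ (12 * k) <= 2 ^ b)%N).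

Let S := starts n q k c.
Let x0 : R := (c + k * n)%:R / q%:R.
(** The value at [x0] if every block were equal to [n!]; both the main term and the tail are
    measured against it. *)
Let low : R := (n`!%:R / polar n x0) ^+ b.

Let q0 : (0 < q)%N. Proof. exact: leq_trans cq. Qed.
Let k0 : (0 < k)%N. Proof. exact: leq_trans qk. Qed.
Let qr : 0 < q%:R :> R. Proof. by rewrite ltr0n. Qed.
Let nr : 0 < n%:R :> R. Proof. by rewrite ltr0n. Qed.

Let ler_expr (x y : R) m : 0 <= x -> x <= y -> x ^+ m <= y ^+ m.
Proof. by move=> h1 h2; apply: lerXn2r => //; rewrite nnegrE // (le_trans h1). Qed.


Let Sb : (size S <= b)%N.
Proof. apply: leq_trans (size_starts_le n0 c0 cq qk qn) _; have := exponent_ge k0 hb; clear; lia. Qed.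

Lemma x0_ge : r%:R * n%:R <= x0.
Proof.
by rewrite ler_pdivlMr // -!natrM ler_nat krq mulnAC leq_addl.
Qed.

Lemma x0_le : x0 <= r%:R * n%:R + 1.
Proof.
rewrite ler_pdivrMr // -natrM natr1 -natrM ler_nat krq mulSn mulnAC leq_add2r //.
Qed.

Let x0_gt0 : 0 < x0.
Proof. by rewrite divr_gt0 // ltr0n; lia. Qed.

Lemma polar_gt0 (x : R) : 0 < x -> 0 < polar n x.
Proof. by move=> h; apply: prodr_gt0 => i _; rewrite ltr_wpDr. Qed.

Lemma polar_x0_le : polar n x0 <= ((r + 2)%:R * n%:R) ^+ n.+1.
Proof.
rewrite -[X in _ ^+ X]card_ord -prodr_const; apply: ler_prod => -[i ih] _ /=.
rewrite addr_ge0 ?(ltW x0_gt0) //=; apply: (le_trans (lerD x0_le (lexx _))).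
have : i%:R <= n%:R :> R by rewrite ler_nat -ltnS.
have : 1 <= n%:R :> R by rewrite ler1n.
rewrite natrD; lra.
Qed.

Lemma polar_x0_ge : (r%:R * n%:R) ^+ n <= polar n x0.
Proof.
have h1 : 1 <= r%:R * n%:R :> R by rewrite -natrM ler1n; nia.
apply: (@le_trans _ _ ((r%:R * n%:R) ^+ n.+1)); first by rewrite ler_weXn2l.
rewrite -[X in _ ^+ X]card_ord -prodr_const; apply: ler_prod => -[i ih] _ /=.
by rewrite (le_trans ler01 h1) /= ler_wpDr // x0_ge.
Qed.

Lemma block_le z m (M : nat) : z \in S -> (m + 6 * k * n + n <= M)%N ->
  `|block n q z (m%:R / q%:R : R)| <= M%:R ^+ n.
Proof.
move=> zs hM; have := block_grid R n z m%:Z q0; rewrite -pmulrn => ->.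
rewrite -intr_norm -natrX -[(M ^ n)%:R]/((M ^ n)%N%:Z%:~R) ler_int.
have : (`|rising (m%:Z + z) n| <= M ^ n)%N.
  apply: rising_le; have := starts_le n0 c0 cq qk qn zs; lia.
by rewrite -lez_nat abszE.
Qed.

Lemma low_ge : (((r + 2)%:R * n%:R) * (4 * (r + 2)%:R) ^+ n) ^- b <= low.
Proof.
have P0 := polar_gt0 x0_gt0.
have r20 : 0 < (r + 2)%:R :> R by rewrite ltr0n; lia.
have D0 : 0 < (r + 2)%:R * n%:R * (4 * (r + 2)%:R) ^+ n :> R by rewrite !mulr_gt0 ?exprn_gt0 ?mulr_gt0.
rewrite /low -exprVn; apply: lerXn2r; rewrite ?nnegrE ?invr_ge0 ?divr_ge0 ?(ltW P0) ?(ltW D0) //.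
rewrite ler_pdivlMr // ler_pdivrMl //.
apply: (le_trans polar_x0_le); rewrite exprS -[X in _ <= X]mulrA ler_wpM2l ?mulr_ge0 //.
rewrite [4 * _]mulrC !exprMn -mulrA ler_wpM2l ?exprn_ge0 //.
by rewrite -!natrX -natrM ler_nat expnn_le.
Qed.

Lemma Rfun_main_ge : low <= `|Rfun n q k c b x0|.
Proof.
rewrite RfunE // normrM normfV normrM !normrX (ger0_norm (ltW (polar_gt0 x0_gt0))).
rewrite normr_nat /low expr_div_n ler_wpM2r ?invr_ge0 ?exprn_ge0 ?(ltW (polar_gt0 _)) //.
rewrite -{1}(subnKC Sb) exprD ler_wpM2r ?exprn_ge0 // normr_prod.
rewrite -[size S]count_predT -iter_mulr_1 -big_const_seq big_seq [X in _ <= X]big_seq.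
apply: ler_prod => z zs; rewrite ler0n /=.
have := block_grid R n z (c + k * n)%N%:Z q0; rewrite -pmulrn -/x0 => ->.
rewrite -intr_norm -[n`!%:R]/(n`!%:Z%:~R) ler_int -abszE lez_nat.
exact: fact_le_rising (main_point_neq0 n0 c0 cq qk qn zs).
Qed.

Lemma Rfun_le (U x : R) : 0 < x -> n`!%:R <= U ->
  (forall z, z \in S -> `|block n q z x| <= U) ->
  `|Rfun n q k c b x| <= (U / n`!%:R) ^+ (12 * k) * (n`!%:R / polar n x) ^+ b.
Proof.
move=> x_gt0 fU hU; have P0 := polar_gt0 x_gt0.
have f0 : 0 < n`!%:R :> R by rewrite ltr0n fact_gt0.
rewrite RfunE // normrM normfV normrM !normrX (ger0_norm (ltW P0)).
rewrite normr_nat !expr_div_n [X in _ <= X]mulrA ler_wpM2r ?invr_ge0 ?exprn_ge0 ?(ltW P0) //.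
rewrite -{2}(subnKC Sb) exprD mulrA ler_wpM2r ?exprn_ge0 //.
apply: (@le_trans _ _ (U ^+ size S)).
  rewrite normr_prod -[size S]count_predT -iter_mulr_1 -big_const_seq big_seq [X in _ <= X]big_seq.
  by apply: ler_prod => z zs; rewrite normr_ge0 hU.
rewrite -ler_pdivrMr ?exprn_gt0 // -!expr_div_n; apply: ler_weXn2l.
  by rewrite ler_pdivlMr // mul1r.
exact: size_starts_le n0 c0 cq qk qn.
Qed.

Lemma fact_le_natX (M : nat) : (n <= M)%N -> n`!%:R <= M%:R ^+ n :> R.
Proof.
move=> nM; rewrite -natrX ler_nat fact_prod big_add1 /= big_mkord.
have <- : (\prod_(i < n) M = M ^ n)%N by rewrite prod_nat_const card_ord.
by apply: leq_prod => i _; apply: leq_trans (ltn_ord i) nM.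
Qed.

Let nX4 : n%:R ^+ n <= 4 ^+ n * n`!%:R :> R.
Proof. by rewrite -!natrX -natrM ler_nat expnn_le. Qed.

(** The blocks contribute at most [(64 k) ^ (12 k n) <= 2 ^ (b n)]; the poles at most [r ^ (- b n)],
    since every factor of [polar] is at least [r n]. *)
Lemma Rfun_main_le : `|Rfun n q k c b x0| <= (2 / r%:R) ^+ (b * n).
Proof.
have x00 := x0_gt0; have rr : 0 < r%:R :> R by rewrite ltr0n (leq_trans _ r2).
have f0 : 0 < n`!%:R :> R by rewrite ltr0n fact_gt0.
pose M := (9 * k * n)%N.
have kn : (n <= k * n)%N by rewrite leq_pmull.
have [nM cM] : (n <= M)%N /\ (c + k * n + 6 * k * n + n <= M)%N.
  by rewrite /M; move: kn cq qn; clear; lia.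
apply: (le_trans (Rfun_le x00 (fact_le_natX nM) _)).
  by move=> z zs; apply: block_le.
have h1 : M%:R ^+ n / n`!%:R <= (64 * k%:R) ^+ n :> R.
  rewrite ler_pdivrMr // /M natrM exprMn.
  apply: (@le_trans _ _ ((9 * k)%:R ^+ n * (4 ^+ n * n`!%:R))).
    by rewrite ler_wpM2l ?exprn_ge0.
  rewrite mulrA -exprMn ler_wpM2r // ler_expr ?mulr_ge0 //.
  by rewrite -!natrM ler_nat; lia.
have h2 : n`!%:R / polar n x0 <= r%:R ^- n.
  rewrite ler_pdivrMr ?polar_gt0 // ler_pdivlMl ?exprn_gt0 //.
  apply: le_trans polar_x0_ge; rewrite exprMn ler_wpM2l ?exprn_ge0 //.
  exact: fact_le_natX.
apply: (@le_trans _ _ (((64 * k%:R) ^+ n) ^+ (12 * k) * (r%:R ^- n) ^+ b)).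
  have p1 : 0 <= M%:R ^+ n / n`!%:R :> R by rewrite divr_ge0 ?exprn_ge0.
  have p2 : 0 <= n`!%:R / polar n x0 by rewrite divr_ge0 ?(ltW (polar_gt0 _)).
  by apply: ler_pM; rewrite ?exprn_ge0 ?ler_expr.
have e1 : ((64 * k%:R) ^+ n) ^+ (12 * k) = ((64 * k%:R) ^+ (12 * k)) ^+ n :> R.
  by rewrite -!exprM mulnC.
have e2 : (r%:R ^- n) ^+ b = r%:R^-1 ^+ (b * n) :> R by rewrite -exprVn -exprM mulnC.
have e3 : (2 / r%:R) ^+ (b * n) = (2 ^+ b) ^+ n * r%:R^-1 ^+ (b * n) :> R by rewrite -exprM -exprMn.
rewrite e1 e2 e3 ler_wpM2r ?exprn_ge0 ?invr_ge0 // ler_expr ?exprn_ge0 ?mulr_ge0 //.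
have := hb; rewrite -(ler_nat R) !natrM !natrX natrM; apply: le_trans.
by rewrite ler_peMl ?exprn_ge0 ?mulr_ge0 // ler1n.
Qed.

(** With [y = m / (4 k n) >= 1], the blocks gain at most [y ^ (12 k n)] and the poles lose
    [(2 y) ^ (b n)] against their value at [x0]. From [b >= 12 k + 2] comes [y ^ (- 2)], which makes
    the tail summable, and from the factor 2 in the hypothesis on [b] comes [2 ^ (- n)]. *)
Lemma Rfun_tail_le (m : nat) : (c + 4 * k * n < m)%N ->
  `|Rfun n q k c b (m%:R / q%:R : R)| <=
    2 ^- n * (4 * k%:R * n%:R) ^+ 2 / m%:R ^+ 2 * low.
Proof.
move=> hm; have kn : (n <= k * n)%N by rewrite leq_pmull.
pose M := (3 * m)%N.
have [m_gt0 nM mM mk] : [/\ (0 < m)%N, (n <= M)%N, (m + 6 * k * n + n <= M)%N & (4 * k * n <= m)%N].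
  by rewrite /M; move: hm kn n0; clear; split; lia.
have mr : m%:R != 0 :> R by rewrite pnatr_eq0 -lt0n.
set x : R := m%:R / q%:R.
have x00 := x0_gt0.
have rr : 0 < r%:R :> R by rewrite ltr0n (leq_trans _ r2).
have rr2 : 2 <= r%:R :> R by rewrite ler_nat.
have f0 : 0 < n`!%:R :> R by rewrite ltr0n fact_gt0.
have kr : 0 < k%:R :> R by rewrite ltr0n.
have nr1 : 1 <= n%:R :> R by rewrite ler1n.
pose N : R := 4 * k%:R * n%:R.
have N0 : 0 < N by rewrite !mulr_gt0.
have [y yE] : exists y : R, y = m%:R / N by exists (m%:R / N).
have y1 : 1 <= y by rewrite yE ler_pdivlMr // mul1r /N -!natrM ler_nat.
have y0 : 0 < y by apply: lt_le_trans y1.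
have xy : x = 4 * r%:R * n%:R * y.
  rewrite /x yE /N krq natrM; field.
  by rewrite !gt_eqF.
have x_gt0 : 0 < x by rewrite divr_gt0 // ltr0n.
have ME : M%:R = 12 * k%:R * n%:R * y.
  rewrite /M natrM yE /N; field.
  by rewrite !gt_eqF.
apply: (le_trans (Rfun_le x_gt0 (fact_le_natX nM) _)).
  by move=> z zs; apply: block_le.
have h1 : M%:R ^+ n / n`!%:R <= (64 * k%:R * y) ^+ n :> R.
  rewrite ler_pdivrMr // ME [12 * k%:R * n%:R * y]mulrAC exprMn.
  apply: (@le_trans _ _ ((12 * k%:R * y) ^+ n * (4 ^+ n * n`!%:R))).
    by rewrite ler_wpM2l ?exprn_ge0 ?mulr_ge0 ?(ltW y0).
  rewrite mulrA -exprMn ler_wpM2r // ler_expr ?mulr_ge0 ?(ltW y0) //.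
  have := mulr_gt0 kr y0; lra.
have h2 : n`!%:R / polar n x <= (2 * y) ^- n * (n`!%:R / polar n x0).
  (* Here the zeros up to [4 k n] matter: [x = 4 r n y], whereas [x0 + j <= (r + 1) n + 1 <= 2 r n],
     so each factor of [polar] grows by at least [2 y]. *)
  have e : polar n x0 * (2 * y) ^+ n <= polar n x.
    apply: (@le_trans _ _ (polar n x0 * (2 * y) ^+ n.+1)).
      apply: ler_wpM2l; first by rewrite ltW ?polar_gt0.
      by apply: ler_weXn2l; [lra|].
    rewrite -[X in _ ^+ X]card_ord -prodr_const -big_split /=.
    apply: ler_prod => -[i ih] _ /=.
    have : 0 <= i%:R :> R by [].
    have : i%:R <= n%:R :> R by rewrite ler_nat -ltnS.
    have := x0_le; rewrite xy; move: (i%:R : R) => w xle wn w0.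
    have z0 : 0 <= x0 + w by lra.
    rewrite mulr_ge0 //=; last by lra.
    apply: (@le_trans _ _ ((r%:R * n%:R + 1 + n%:R) * (2 * y))).
      by apply: ler_wpM2r; lra.
    apply: (@le_trans _ _ (2 * (r%:R * n%:R) * (2 * y))); last by lra.
    apply: ler_wpM2r; first by lra.
    have : 2 * n%:R <= r%:R * n%:R :> R by rewrite ler_wpM2r.
    lra.
  have -> : (2 * y) ^- n * (n`!%:R / polar n x0) = n`!%:R / (polar n x0 * (2 * y) ^+ n).
    by rewrite invfM mulrCA [X in _ * X]mulrC.
  have y2 : 0 < 2 * y by lra.
  have Pp : 0 < polar n x0 * (2 * y) ^+ n by rewrite mulr_gt0 ?exprn_gt0 ?polar_gt0.
  by rewrite ler_wpM2l // lef_pV2 ?posrE // polar_gt0.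
apply: (@le_trans _ _ (((64 * k%:R * y) ^+ n) ^+ (12 * k) * ((2 * y) ^- n * (n`!%:R / polar n x0)) ^+ b)).
  have p1 : 0 <= M%:R ^+ n / n`!%:R :> R by rewrite divr_ge0 ?exprn_ge0.
  have p2 : 0 <= n`!%:R / polar n x by rewrite divr_ge0 ?(ltW (polar_gt0 _)).
  by apply: ler_pM; rewrite ?exprn_ge0 ?ler_expr.
rewrite [X in _ * X]exprMn -/low mulrA ler_wpM2r ?exprn_ge0 ?divr_ge0 ?(ltW (polar_gt0 _)) //.
have -> : 2 ^- n * (4 * k%:R * n%:R) ^+ 2 / m%:R ^+ 2 = 2 ^- n * y ^- 2 :> R.
  by rewrite -/N -mulrA; congr (_ * _); rewrite yE; field; rewrite mr gt_eqF.
have bk := exponent_ge k0 hb.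
pose a := (64 * k%:R * y) ^+ (12 * k) * (2 * y) ^- b.
have aE : a <= 2^-1 * y ^- 2.
  rewrite /a ler_pdivrMr ?exprn_gt0 ?mulr_gt0 // exprMn.
  have yb : y ^+ (12 * k) <= y ^- 2 * y ^+ b.
    by rewrite mulrC ler_pdivlMr ?exprn_gt0 // -exprD ler_weXn2l.
  have := hb; rewrite -(ler_nat R) !natrM !natrX natrM => h.
  apply: (@le_trans _ _ ((2^-1 * 2 ^+ b) * (y ^- 2 * y ^+ b))).
    apply: ler_pM; rewrite ?exprn_ge0 ?mulr_ge0 ?(ltW y0) //; lra.
  by rewrite exprMn le_eqVlt; apply/orP; left; apply/eqP; ring.
have a0 : 0 <= a by rewrite /a mulr_ge0 ?invr_ge0 ?exprn_ge0 ?mulr_ge0 ?(ltW y0).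
apply: (@le_trans _ _ (a ^+ n)).
  have e1 : ((64 * k%:R * y) ^+ n) ^+ (12 * k) = ((64 * k%:R * y) ^+ (12 * k)) ^+ n :> R.
    by rewrite -!exprM mulnC.
  have e2 : ((2 * y) ^- n) ^+ b = ((2 * y) ^- b) ^+ n by rewrite -!exprVn -!exprM mulnC.
  by rewrite /a e1 e2 -exprMn.
apply: (@le_trans _ _ ((2^-1 * y ^- 2) ^+ n)).
  by rewrite ler_expr.
rewrite exprMn exprVn ler_wpM2l ?invr_ge0 ?exprn_ge0 // -{2}[y ^- 2]expr1.
by rewrite ler_wiXn2l ?invr_ge0 ?exprn_ge0 ?(ltW y0) // invf_le1 ?exprn_gt0 // exprn_ege1.
Qed.

End Bounds.

(** * Linear forms in the values *)

(** A prime dividing both quotients divides [v] and [w] to a power beyond its exponent in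
    [lcmto n * N]; so does it divide [h N], a divisor of [lcmto n * N]. *)
Lemma coprime_reduced (n N v w : nat) : (0 < N)%N -> (0 < v)%N -> (0 < w)%N ->
  (exists2 h, (0 < h <= n)%N & (v + w = h * N \/ v = w + h * N \/ w = v + h * N)%N) ->
  coprime (v %/ gcdn v (lcmto n * N)) (w %/ gcdn w (lcmto n * N)).
Proof.
move=> N0 v0 w0 [h hn hvw].
have LN0 : (0 < lcmto n * N)%N by rewrite muln_gt0 lcmto_gt0.
have key u p : (0 < u)%N -> prime p -> (p %| u %/ gcdn u (lcmto n * N))%N ->
    (p ^ (logn p (lcmto n * N)).+1 %| u)%N.
  move=> u0 pp pd.
  have q0 : (0 < u %/ gcdn u (lcmto n * N))%N.
    by rewrite divn_gt0 ?gcdn_gt0 ?u0 // dvdn_leq // dvdn_gcdl.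
  have : (0 < logn p (u %/ gcdn u (lcmto n * N)))%N by rewrite logn_gt0 mem_primes pp q0.
  rewrite logn_div ?dvdn_gcdl // logn_gcd // => lt.
  rewrite pfactor_dvdn //; lia.
apply/negPn/negP => ne.
have q0 : (0 < v %/ gcdn v (lcmto n * N))%N.
  by rewrite divn_gt0 ?gcdn_gt0 ?v0 // dvdn_leq // dvdn_gcdl.
have [|p pp pd] := @pdivP (gcdn (v %/ gcdn v (lcmto n * N)) (w %/ gcdn w (lcmto n * N))).
  by rewrite ltn_neqAle gcdn_gt0 q0 eq_sym ne.
move: pd; rewrite dvdn_gcd => /andP[/(key _ _ v0 pp) pv /(key _ _ w0 pp) pw].
have : (p ^ (logn p (lcmto n * N)).+1 %| h * N)%N.
  case: hvw => [<-|[e|e]]; first by rewrite dvdn_add.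
    by move: pv; rewrite e dvdn_addr.
  by move: pw; rewrite e dvdn_addr.
move/dvdn_trans/(_ (dvdn_mul (dvdn_lcmto hn) (dvdnn N))).
by rewrite pfactor_dvdn // ltnn.
Qed.

Section LinearForms.
Variables (R : archiRealFieldType) (n b N : nat) (c : nat -> nat -> R).

Let L : R := (lcmto n)%:R.

Hypotheses (N0 : (0 < N)%N)
  (c_int : forall i j, (i < b)%N -> L ^+ (b - i.+1) * c i j \is a Num.int).

Let Nr : 0 < N%:R :> R. Proof. by rewrite ltr0n. Qed.

Definition polar_part (j : nat) (y : R) : R := \sum_(i < b) c i j / y ^+ i.+1.

(** Up to sign, the coefficient of [f(- mu)]: sums over [m + j N] are completed to partial sums from
    1 by terms with argument [j N - mu], [0 <= mu < j N], where [f] takes the value [f(- mu)]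
    because [T] divides [N]. *)
Definition upper_part (mu : nat) : R :=
  \sum_(j < n.+1 | (mu < j * N)%N) polar_part j (j%:R - mu%:R / N%:R).

Lemma polar_part_int j (y : R) (e : nat) : e%:R * (L / y) \is a Num.int -> (0 < e)%N ->
  e%:R ^+ b * (L ^+ b * polar_part j y) \is a Num.int.
Proof.
move=> h e0; rewrite /polar_part !mulr_sumr rpred_sum // => i _.
have ib := ltn_ord i.
have -> : e%:R ^+ b * (L ^+ b * (c i j / y ^+ i.+1)) =
   e%:R ^+ (b - i.+1) * (L ^+ (b - i.+1) * c i j) * (e%:R * (L / y)) ^+ i.+1.
  rewrite -{1 2}(subnK ib) !exprD !exprMn exprVn; ring.
by rewrite rpredM ?rpredX // rpredM ?rpredX ?rpred_nat ?c_int.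
Qed.

(* When [mu / N] is not an integer the upper part is minus the lower part, and
   their denominators are coprime outside [L]: a prime power dividing both
   [j N - mu] and [j' N - mu] divides [(j - j') N]. Hence [L] alone clears the
   denominators, although [j N - mu] may be as large as [n N]. *)
Lemma upper_part_int mu :
  (~~ (N %| mu)%N -> pfeval n b c (- (mu%:R / N%:R)) = 0) ->
  L ^+ b * upper_part mu \is a Num.int.
Proof.
have N1 : N%:R != 0 :> R by rewrite gt_eqF.
have [/dvdnP[k ->] _|ndvd /(_ isT) van] := boolP (N %| mu)%N.
  rewrite /upper_part mulr_sumr rpred_sum // => j.
  rewrite ltn_pmul2r // natrM mulfK // => kj.
  have := @polar_part_int j (j%:R - k%:R) 1.
  rewrite expr1n !mul1r; apply=> //.
  have jn : (j <= n)%N by rewrite -ltnS.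
  by apply: lcmto_div_int => //; [exact: (leq_trans (ltnW kj)) | rewrite ltn_eqF].
pose v (j : nat) : nat := `|(j * N)%N%:Z - mu%:Z|%N.
have vN0 j : (0 < v j)%N.
  rewrite /v absz_gt0 subr_eq0; apply: contra ndvd => /eqP [<-]; exact: dvdn_mull.
pose e j := (v j %/ gcdn (v j) (lcmto n * N))%N.
have e0 j : (0 < e j)%N by rewrite divn_gt0 ?gcdn_gt0 ?vN0 // dvdn_leq // dvdn_gcdl.
have eint j : (e j)%:R * (L / (j%:R - mu%:R / N%:R)) \is a Num.int.
  pose d : int := (j * N)%N%:Z - mu%:Z.
  have dE : j%:R - mu%:R / N%:R = d%:~R / N%:R :> R.
    by rewrite /d rmorphB /= -!pmulrn natrM mulrBl mulfK.
  have [w wE] := dvdnP (dvdn_gcdr (v j) (lcmto n * N)).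
  have vE : (v j = e j * gcdn (v j) (lcmto n * N))%N by rewrite /e divnK // dvdn_gcdl.
  have g0 : (gcdn (v j) (lcmto n * N))%:R != 0 :> R.
    by rewrite pnatr_eq0 -lt0n gcdn_gt0 vN0.
  have er : (e j)%:R != 0 :> R by rewrite pnatr_eq0 -lt0n.
  have vr : (e j)%:R * (L * N%:R / (v j)%:R) = w%:R.
    by rewrite /L -natrM wE {2}vE !natrM; field; rewrite er g0.
  have -> : (e j)%:R * (L / (j%:R - mu%:R / N%:R)) = (e j)%:R * (L * N%:R / d%:~R).
    by congr (_ * _); rewrite dE invf_div mulrA.
  have : d%:~R = (v j)%:R :> R \/ d%:~R = - (v j)%:R :> R.
    have : d = (v j)%:Z \/ d = - (v j)%:Z by rewrite /v -/d; lia.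
    by case=> ->; [left|right; rewrite rmorphN].
  by case=> ->; rewrite ?invrN ?mulrN ?rpredN vr rpred_nat.
pose lower := \sum_(j < n.+1 | ~~ (mu < j * N)%N) polar_part j (j%:R - mu%:R / N%:R).
have ul : upper_part mu = - lower.
  have tot : upper_part mu + lower = \sum_(j < n.+1) polar_part j (j%:R - mu%:R / N%:R).
    by rewrite [RHS](bigID (fun j : 'I_n.+1 => (mu < j * N)%N)).
  apply/eqP; rewrite -addr_eq0 tot; apply/eqP.
  rewrite -[RHS]van /pfeval exchange_big /=; apply: eq_bigr => j _.
  by apply: eq_bigr => i _; rewrite addrC.
have clear_den (P : pred nat) : (\prod_(j < n.+1 | P j) e j ^ b)%N%:R *
   (L ^+ b * \sum_(j < n.+1 | P j) polar_part j (j%:R - mu%:R / N%:R)) \is a Num.int.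
  rewrite !mulr_sumr rpred_sum // => j Pj.
  rewrite (bigD1 j) //= natrM mulrAC natrX rpredM ?rpred_nat //.
  exact: polar_part_int.
have := clear_den (fun j => ~~ (mu < j * N)%N); rewrite -/lower.
have := clear_den (fun j => (mu < j * N)%N); rewrite -/(upper_part mu).
set A := (\prod_(j < n.+1 | _) _)%N; set B := (\prod_(j < n.+1 | _) _)%N => hA hB.
have cop : coprime A B.
  rewrite /A /B; apply: (big_ind (fun x => coprime x _)) => [|x y|j jP].
  - exact: coprime1n.
  - by rewrite coprimeMl => -> ->.
  apply: (big_ind (fun x => coprime _ x)) => [|x y|j' jP'].
  - exact: coprimen1.
  - by rewrite coprimeMr => -> ->.
  apply: coprimeXl; apply: coprimeXr; apply: coprime_reduced => //.
  rewrite -leqNgt in jP'.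
  exists (j - j')%N.
    by have := ltn_ord j; have := leq_ltn_trans jP' jP; rewrite ltn_pmul2r //; lia.
  left; rewrite /v mulnBl.
  have : (mu < j * N)%N := jP.
  lia.
have /coprimezP [[s t] /= st] : coprimez A%:Z B%:Z by rewrite /coprimez /gcdz /= -/(coprime A B).
have -> : L ^+ b * upper_part mu = s%:~R * (A%:R * (L ^+ b * upper_part mu)) -
    t%:~R * (B%:R * (L ^+ b * lower)).
  have : (s * A%:Z + t * B%:Z)%:~R = 1 :> R by rewrite st.
  rewrite rmorphD !rmorphM /= -!pmulrn => st1.
  rewrite -[LHS](mul1r (L ^+ b * upper_part mu)) -[X in X * _ = _]st1 ul; ring.
by apply: rpredB; apply: rpredM => //; exact: intr_int.
Qed.

Lemma upper_part_le mu (C : R) : \sum_(i < b) \sum_(j < n.+1) `|c i j| <= C ->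
  `|upper_part mu| <= N%:R ^+ b * C.
Proof.
move=> hC; apply: (@le_trans _ _ (\sum_(j < n.+1) \sum_(i < b) N%:R ^+ b * `|c i j|)).
  apply: (le_trans (ler_norm_sum _ _ _)); rewrite [X in _ <= X](bigID (fun j : 'I_n.+1 => mu < j * N)%N) /=.
  apply: ler_wpDr; first by do 2!rewrite sumr_ge0 // => *; rewrite mulr_ge0 // exprn_ge0 // ltW.
  apply: ler_sum => j muj; apply: (le_trans (ler_norm_sum _ _ _)).
  apply: ler_sum => i _; rewrite normrM mulrC ler_wpM2r // normfV normrX.
  have y1 : N%:R^-1 <= `|j%:R - mu%:R / N%:R| :> R.
    rewrite ger0_norm; last first.
      by rewrite subr_ge0 ler_pdivrMr // -natrM ler_nat ltnW.
    by rewrite lerBrDr -[X in X + _ <= _]mul1r -mulrDl ler_pdivrMr // nat1r -natrM ler_nat.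
  have y0 : 0 < `|j%:R - mu%:R / N%:R| :> R by apply: lt_le_trans y1; rewrite invr_gt0.
  rewrite -exprVn; apply: (@le_trans _ _ (N%:R ^+ i.+1)).
    have y2 : `|j%:R - mu%:R / N%:R|^-1 <= N%:R :> R.
      by rewrite -[X in _ <= X]invrK lef_pV2 ?posrE ?invr_gt0.
    by apply: lerXn2r; rewrite ?nnegrE ?invr_ge0 ?normr_ge0 ?ler0n.
  by rewrite ler_weXn2l ?ler1n.
rewrite exchange_big /=; apply: le_trans (ler_wpM2l _ hC); last by rewrite exprn_ge0 // ltW.
by rewrite mulr_sumr ler_sum // => i _; rewrite mulr_sumr.
Qed.

Definition Lpart (f : int -> R) (s M : nat) : R :=
  \sum_(0 <= m < M) f m.+1%:Z / m.+1%:R ^+ s.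

(** The pole at [- j] shifts the summation variable by [j N]. The identity is exact for partial
    sums, so the possible divergence of [L(f, 1)] does no harm before elimination. *)
Lemma linear_form (T M : nat) (f : int -> R) : (forall x : int, f (x + T%:Z) = f x) ->
  (T %| N)%N ->
  \sum_(0 <= m < M) f m.+1%:Z * pfeval n b c (m.+1%:R / N%:R) =
  \sum_(i < b) \sum_(j < n.+1) c i j * N%:R ^+ i.+1 * Lpart f i.+1 (M + j * N) -
  \sum_(mu < n * N) f (- mu%:Z) * upper_part mu.
Proof.
move=> fT /dvdnP[k kE].
have fk (x : int) (h : nat) : f (x + (h * T)%N%:Z) = f x.
  elim: h => [|h IH]; first by rewrite mul0n addr0.
  by rewrite mulSn PoszD [(T%:Z + _)]addrC addrA fT IH.
have fN (x : int) (j : nat) : f (x + (j * N)%N%:Z) = f x by rewrite kE mulnA fk.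
have N1 : N%:R != 0 :> R by rewrite gt_eqF.
apply/eqP; rewrite eq_sym subr_eq eq_sym; apply/eqP.
have E1 : \sum_(mu < n * N) f (- mu%:Z) * upper_part mu =
   \sum_(i < b) \sum_(j < n.+1) \sum_(mu < j * N)
      f (- mu%:Z) * (c i j / (j%:R - mu%:R / N%:R) ^+ i.+1).
  transitivity (\sum_(mu < n * N) \sum_(j < n.+1) \sum_(i < b) if (mu < j * N)%N then
      f (- mu%:Z) * (c i j / (j%:R - mu%:R / N%:R) ^+ i.+1) else 0).
    apply: eq_bigr => mu _; rewrite /upper_part mulr_sumr big_mkcond /=.
    apply: eq_bigr => j _; case: ifP => _; last by rewrite big1.
    by rewrite /polar_part mulr_sumr.
  rewrite exchange_big /= [RHS]exchange_big /=; apply: eq_bigr => j _.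
  rewrite exchange_big /=; apply: eq_bigr => i _.
  rewrite -big_mkcond /= [RHS](big_ord_widen (n * N)
    (fun mu => f (- mu%:Z) * (c i j / (j%:R - mu%:R / N%:R) ^+ i.+1))) //.
  by rewrite leq_mul2r -ltnS ltn_ord orbT.
have E2 : \sum_(0 <= m < M) f m.+1%:Z * pfeval n b c (m.+1%:R / N%:R) =
    \sum_(i < b) \sum_(j < n.+1) \sum_(0 <= m < M)
      f m.+1%:Z * (c i j / (m.+1%:R / N%:R + j%:R) ^+ i.+1).
  under eq_bigr do rewrite /pfeval mulr_sumr.
  rewrite exchange_big /=; apply: eq_bigr => i _.
  under eq_bigr do rewrite mulr_sumr.
  by rewrite exchange_big.
rewrite E1 E2 -big_split /=; apply: eq_bigr => i _.
rewrite -big_split /=; apply: eq_bigr => j _.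
rewrite /Lpart [X in _ * X](@big_cat_nat _ _ _ (j * N)) //=; last by rewrite leq_addl.
rewrite mulrDr addrC; congr (_ + _).
  rewrite -(big_mkord xpredT (fun mu => f (- mu%:Z) * (c i j / (j%:R - mu%:R / N%:R) ^+ i.+1))).
  rewrite [X in _ = _ * X]big_nat_rev /= mulr_sumr big_nat [RHS]big_nat; apply: eq_bigr => mu /= mujN.
  have e : (0 + j * N - mu.+1).+1 = (j * N - mu)%N by lia.
  have e0 : (j * N - mu)%N%:R != 0 :> R by rewrite pnatr_eq0 -lt0n subn_gt0.
  have -> : j%:R - mu%:R / N%:R = (j * N - mu)%N%:R / N%:R :> R.
    by rewrite natrB ?natrM 1?ltnW // mulrBl mulfK.
  rewrite e (_ : f (j * N - mu)%N%:Z = f (- mu%:Z)); last by rewrite -[RHS](fN _ j) addrC subzn 1?ltnW.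
  rewrite expr_div_n; field.
  by rewrite !expf_neq0.
have := big_addn 0 (M + j * N) (j * N) xpredT (fun m => f m.+1%:Z / m.+1%:R ^+ i.+1 : R).
rewrite add0n addnK => ->; rewrite mulr_sumr; apply: eq_bigr => m _.
have e0 : (m.+1 + j * N)%N%:R != 0 :> R by rewrite pnatr_eq0.
have -> : m.+1%:R / N%:R + j%:R = (m.+1 + j * N)%N%:R / N%:R :> R.
  by rewrite natrD natrM mulrDl mulfK.
rewrite -addSn PoszD fN expr_div_n; field.
by rewrite !expf_neq0.
Qed.

End LinearForms.

Lemma sum_inv_sqr_le (R : realFieldType) M :
  \sum_(0 <= m < M) (m.+1%:R ^+ 2)^-1 <= 2 :> R.
Proof.
case: M => [|M]; first by rewrite big_nil.
suff : \sum_(0 <= m < M.+1) (m.+1%:R ^+ 2)^-1 <= 2 - M.+1%:R^-1 :> R.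
  move/le_trans; apply; rewrite gerBl invr_ge0 //.
elim: M => [|M IH]; first by rewrite big_nat1 expr1n invr1; lra.
rewrite big_nat_recr //=; apply: (le_trans (lerD IH (lexx _))).
have h : 0 < M.+1%:R :> R by rewrite ltr0n.
rewrite -[M.+2%:R]natr1; move: (M.+1%:R : R) h => x h.
have : 0 <= x^-1 - (x + 1)^-1 - ((x + 1) ^+ 2)^-1.
  have -> : x^-1 - (x + 1)^-1 - ((x + 1) ^+ 2)^-1 = (x * (x + 1) ^+ 2)^-1.
    by field; rewrite !gt_eqF //; lra.
  by rewrite invr_ge0 mulr_ge0 ?exprn_ge0 //; lra.
lra.
Qed.

(** * Dirichlet convolution of the weights with the periodic function *)

Section Convolution.
Variables (R : realFieldType) (T D : nat) (f : int -> R) (J : finType) (e : J -> nat) (w : J -> int).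
Hypotheses (T0 : (0 < T)%N) (D0 : (0 < D)%N) (fT : forall x : int, f (x + T%:Z) = f x)
  (e_inj : injective e) (eD : forall i, (e i %| D)%N).

Definition convolution (m : nat) : R :=
  \sum_(i | (e i %| m)%N) (w i)%:~R * f (m %/ e i)%N%:Z.

Lemma periodicM (x : int) (h : nat) : f (x + (h * T)%N%:Z) = f x.
Proof.
elim: h => [|h IH]; first by rewrite mul0n addr0.
by rewrite mulSn PoszD [(T%:Z + _)]addrC addrA fT IH.
Qed.

Lemma convolution_periodic m h : convolution (m + h * (D * T)) = convolution m.
Proof.
have dv i : (e i %| h * (D * T))%N by rewrite dvdn_mull // dvdn_mulr.
rewrite /convolution; apply: eq_big => i; first by rewrite dvdn_addl.
rewrite dvdn_addl // => dm; congr (_ * _); rewrite divnDl //.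
have -> : (h * (D * T) %/ e i = (h * (D %/ e i)) * T)%N.
  by rewrite [(D * T)%N]mulnC mulnA -muln_divA // mulnAC.
by rewrite PoszD periodicM.
Qed.

Lemma periodic_nonzero : (exists x, f x != 0) -> exists2 m, (0 < m <= T)%N & f m%:Z != 0.
Proof.
(* A multiple of [T] makes the argument nonnegative; subtracting 1 before reduction modulo [T] puts
   the representative in [[1, T]]. *)
case=> x fx; pose y := (x - 1 + (`|x - 1|%N * T)%N%:Z)%R.
have y0 : (0 <= y)%R by rewrite /y; nia.
have yE : y = `|y|%N%:Z by rewrite gez0_abs.
exists (`|y| %% T).+1; first by rewrite ltn_pmod.
rewrite -(periodicM _ (`|y| %/ T)).
have -> : (`|y| %% T).+1%:Z + (`|y| %/ T * T)%N%:Z = x + (`|x - 1| * T)%N%:Z.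
  have := divn_eq `|y| T; have : `|y|%N%:Z = y by rewrite gez0_abs.
  rewrite /y; lia.
by rewrite periodicM.
Qed.

(* As for Dirichlet series, the least [e i] with [w i != 0] times the least
   [m > 0] with [f m != 0] has a single representation. *)
Lemma convolution_neq0 : (exists x, f x != 0) -> (exists i, w i != 0) ->
  exists2 m, (0 < m <= D * T)%N & convolution m != 0.
Proof.
move=> /periodic_nonzero [m0 m0T fm0] [i0 wi0].
have ex_i : exists i, w i != 0 by exists i0.
have e_gt0 i : (0 < e i)%N by rewrite (dvdn_gt0 D0).
case: (arg_minnP (P := fun i => w i != 0) e wi0) => i wi imin.
have exm : exists m, (0 < m)%N && (f m%:Z != 0) by exists m0; case/andP: m0T => ->.
case: (ex_minnP exm) => m /andP[m_gt0 fm] mmin.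
have mT : (m <= T)%N.
  by case/andP: m0T => m00 /(leq_trans _)-> //; apply: mmin; rewrite m00.
exists (e i * m)%N; first by rewrite muln_gt0 e_gt0 m_gt0 leq_mul // dvdn_leq.
rewrite /convolution (bigD1 i) ?dvdn_mulr //= mulKn // big1 ?addr0 ?mulf_neq0 ?intr_eq0 //.
move=> j /andP[/dvdnP[h hE] ji]; rewrite hE mulnK //.
have [->|wj] := eqVneq (w j) 0; first by rewrite mul0r.
have [->|fh] := eqVneq (f h%:Z) 0; first by rewrite mulr0.
have h0 : (0 < h)%N by move: hE; case: h {fh} => //; have := e_gt0 i; nia.
have := mmin h; rewrite h0 fh => /(_ isT) mh.
have eij := imin j wj.
have : e j = e i.
  apply/eqP; rewrite eqn_leq eij andbT -(leq_pmul2r m_gt0) hE mulnC leq_mul2r mh orbT //.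
by move/e_inj => eji; rewrite eji eqxx in ji.
Qed.

End Convolution.

(** * The weighted sum over the sample points *)

Section MainSum.
Variables (R : archiRealFieldType) (n k c r b T D : nat) (f : int -> R) (F : R)
  (J : finType) (e : J -> nat) (w : J -> int).
Let q := (D * T)%N.
Hypotheses (n0 : (0 < n)%N) (c0 : (0 < c)%N) (cq : (c <= q)%N) (qk : (q <= k)%N) (qn : (q <= n)%N).
Hypotheses (krq : k = (r * q)%N) (r2 : (2 <= r)%N) (hb : (2 * (64 * k) ^ (12 * k) <= 2 ^ b)%N).
Hypotheses (T0 : (0 < T)%N) (D0 : (0 < D)%N) (fF : forall x, `|f x| <= F)
  (eD : forall i, (e i %| D)%N).

Let x0 : R := (c + k * n)%:R / q%:R.
Let low : R := (n`!%:R / polar n x0) ^+ b.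

Let q0 : (0 < q)%N. Proof. by rewrite muln_gt0 D0. Qed.
Let e_gt0 i : (0 < e i)%N. Proof. by rewrite (dvdn_gt0 D0). Qed.
Let F0 : 0 <= F. Proof. exact: le_trans (fF 0). Qed.

Lemma grid_point i m : m%:R / (q %/ e i)%N%:R = (m * e i)%N%:R / q%:R :> R.
Proof.
have [d dE] := dvdnP (dvdn_mulr T (eD i)); rewrite -/q in dE.
have d0 : (0 < d)%N by move: q0; rewrite dE; case: (d).
rewrite dE mulnK // !natrM; field.
by rewrite !pnatr_eq0 -!lt0n d0 e_gt0.
Qed.

Let low_ge0 : 0 <= low.
Proof.
rewrite exprn_ge0 // divr_ge0 // ltW // polar_gt0 // divr_gt0 // ltr0n //.
by rewrite addn_gt0 c0.
Qed.

(* Among the sample points, [R] is nonzero only at [c + k n] and beyond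
   [c + 4 k n], where it is exponentially smaller. *)
Lemma main_sum_term i M : (c + k * n <= M)%N ->
  `|\sum_(0 <= m < M) f m.+1%:Z * (2 * Rfun n q k c b (m.+1%:R / (q %/ e i)%N%:R)) -
    (if (e i %| c + k * n)%N then f ((c + k * n) %/ e i)%N%:Z else 0) * (2 * Rfun n q k c b x0)| <=
  4 * F * (2 ^- n * (4 * k%:R * n%:R) ^+ 2) * low.
Proof.
move=> m0M; pose m0 := (c + k * n)%N; pose u := 2 ^- n * (4 * k%:R * n%:R) ^+ 2 : R.
have u0 : 0 <= u by rewrite mulr_ge0 ?invr_ge0 ?exprn_ge0 ?mulr_ge0.
have z0 : 0 <= 2 * F * u * low by do 2!apply: mulr_ge0 => //; apply: mulr_ge0.
have -> : (if (e i %| m0)%N then f (m0 %/ e i)%N%:Z else 0) * (2 * Rfun n q k c b x0) =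
   \sum_(0 <= m < M) (if (m.+1 * e i == m0)%N then f m.+1%:Z * (2 * Rfun n q k c b x0) else 0).
  case: ifP => [/dvdnP[h hE]|nd].
    have h0 : (0 < h)%N by move: hE; rewrite /m0; case: h => //; lia.
    have hM : (h.-1 < M)%N.
      rewrite prednK // (leq_trans _ m0M) // -/m0 hE leq_pmulr //.
    rewrite big_mkord (bigD1 (Ordinal hM)) //= prednK // hE eqxx mulnK // big1 ?addr0 //.
    move=> j; rewrite -val_eqE /= => jh; case: eqP => // /eqP; rewrite eqn_pmul2r // => /eqP jE.
    by move: jh; rewrite -jE eqxx.
  rewrite mul0r big1 // => m _; case: eqP => // h.
  by move: nd; rewrite -h dvdn_mull.
rewrite -sumrB; apply: (le_trans (ler_norm_sum _ _ _)).
apply: (@le_trans _ _ (\sum_(0 <= m < M) 2 * F * u * low * (m.+1%:R ^+ 2)^-1)); last first.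
  rewrite -mulr_sumr; apply: (@le_trans _ _ (2 * F * u * low * 2)).
    apply: ler_wpM2l; [exact: z0 | exact: sum_inv_sqr_le].
  by rewrite -/u le_eqVlt; apply/orP; left; apply/eqP; ring.
apply: ler_sum => m _; rewrite grid_point.
have rhs0 : 0 <= 2 * F * u * low * (m.+1%:R ^+ 2)^-1.
  by apply: mulr_ge0 z0 _; rewrite invr_ge0 exprn_ge0.
have Sb : (size (starts n q k c) <= b)%N.
  apply: leq_trans (size_starts_le n0 c0 cq qk qn) _.
  have := exponent_ge (leq_trans q0 qk) hb; clear; lia.
have [E|ne] := eqVneq (m.+1 * e i)%N m0.
  by rewrite E subrr normr0.
rewrite subr0; have [le|gt] := leqP (m.+1 * e i) (c + 4 * k * n).
  rewrite Rfun_pos_zero ?mulr0 ?normr0 //; last exact/eqP.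
  by rewrite muln_gt0 e_gt0.
have tl := Rfun_tail_le R n0 c0 cq qk qn krq r2 hb gt.
rewrite 2!normrM [`|2|]ger0_norm //.
apply: (@le_trans _ _ (F * (2 * (u * (m.+1%:R ^+ 2)^-1 * low)))).
  apply: ler_pM; [by [] | by apply: mulr_ge0 | exact: fF |].
  rewrite ler_wpM2l //; apply: (le_trans tl); rewrite -/u -/low ler_wpM2r // ler_wpM2l //.
  rewrite lef_pV2 ?posrE ?exprn_gt0 ?ltr0n ?muln_gt0 ?e_gt0 //.
  by rewrite -!natrX ler_nat leq_exp2r // leq_pmulr.
by rewrite le_eqVlt; apply/orP; left; apply/eqP; ring.
Qed.

Lemma main_sum M : (c + k * n <= M)%N ->
  `|\sum_i (w i)%:~R * \sum_(0 <= m < M)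
       f m.+1%:Z * (2 * Rfun n q k c b (m.+1%:R / (q %/ e i)%N%:R)) -
    convolution f e w (c + k * n) * (2 * Rfun n q k c b x0)| <=
  (\sum_i `|(w i)%:~R|) * (4 * F * (2 ^- n * (4 * k%:R * n%:R) ^+ 2) * low).
Proof.
move=> m0M; have -> : convolution f e w (c + k * n) =
    \sum_i (w i)%:~R * (if (e i %| c + k * n)%N then f ((c + k * n) %/ e i)%N%:Z else 0).
  by rewrite /convolution big_mkcond; apply: eq_bigr => i _; case: ifP; rewrite ?mulr0.
rewrite [X in `|_ - X|]mulr_suml -sumrB [X in _ <= X]mulr_suml.
apply: (le_trans (ler_norm_sum _ _ _)); apply: ler_sum => i _.
apply: le_trans (ler_wpM2l (normr_ge0 (w i)%:~R) (main_sum_term i m0M)).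
rewrite -normrM le_eqVlt; apply/orP; left; apply/eqP; congr (`|_|); ring.
Qed.

End MainSum.

(** * Limits of partial sums *)

Section Tends.
Variable R : archiRealFieldType.
Implicit Types (u v : nat -> R) (l a B : R).

(** An explicit form of the limit, so that the argument up to the contradiction runs over any
    archimedean real field. *)
Definition tends u l :=
  forall eps, 0 < eps -> exists M0, forall M, (M0 <= M)%N -> `|u M - l| <= eps.

Lemma tends_cst a : tends (fun=> a) a.
Proof. by move=> eps e0; exists 0%N => M _; rewrite subrr normr0 ltW. Qed.

Lemma tends_add u v l a : tends u l -> tends v a -> tends (fun M => u M + v M) (l + a).
Proof.
move=> hu hv eps e0; have e2 : 0 < eps / 2 by lra.
have [M1 h1] := hu _ e2; have [M2 h2] := hv _ e2.
exists (maxn M1 M2) => M; rewrite geq_max => /andP[/h1 H1 /h2 H2].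
have -> : u M + v M - (l + a) = (u M - l) + (v M - a) by ring.
by apply: (le_trans (ler_normD _ _)); lra.
Qed.

Lemma tends_scale u l a : tends u l -> tends (fun M => a * u M) (a * l).
Proof.
move=> hu eps e0; have d0 : 0 < eps / (1 + `|a|) by rewrite divr_gt0 // ltr_wpDr.
have [M1 h1] := hu _ d0; exists M1 => M /h1 H1.
rewrite -mulrBr normrM; apply: (le_trans (ler_wpM2l (normr_ge0 a) H1)).
rewrite mulrA ler_pdivrMr ?ltr_wpDr // mulrC ler_wpM2l ?(ltW e0) //; lra.
Qed.

Lemma tends_sum (I : finType) (u : I -> nat -> R) (l : I -> R) :
  (forall i, tends (u i) (l i)) -> tends (fun M => \sum_i u i M) (\sum_i l i).
Proof.
move=> h; elim: (index_enum I) => [|i r IH].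
  by move=> eps e0; exists 0%N => M _; rewrite !big_nil subrr normr0 ltW.
move=> eps e0; have [M0 h0] := tends_add (h i) IH e0.
by exists M0 => M /h0; rewrite !big_cons.
Qed.

Lemma tends_ext u v l : (forall M, u M = v M) -> tends v l -> tends u l.
Proof. by move=> e h eps /h[M0 hM]; exists M0 => M /hM; rewrite e. Qed.

Lemma tends_bound u l a B M0 : tends u l -> (forall M, (M0 <= M)%N -> `|u M - a| <= B) ->
  `|l - a| <= B.
Proof.
move=> h hB; rewrite leNgt; apply/negP => lt.
have d0 : 0 < (`|l - a| - B) / 2 by lra.
have [M1 h1] := h _ d0; have := h1 _ (leq_maxl M1 M0); have := hB _ (leq_maxr M1 M0).
move: (u _) => y H1 H2; have : `|l - a| <= `|y - l| + `|y - a|.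
  have -> : l - a = - (y - l) + (y - a) by ring.
  by apply: (le_trans (ler_normD _ _)); rewrite normrN.
lra.
Qed.

(** The [h] additional terms are at most [F / M] each. The case [s = 1] is included, although the
    partial sums may then diverge. *)
Lemma Lpart_shift (f : int -> R) (F : R) s h : (forall x, `|f x| <= F) -> (0 < s)%N ->
  tends (fun M => Lpart f s (M + h) - Lpart f s M) 0.
Proof.
move=> fF s0 eps e0; have F0 : 0 <= F by apply: le_trans (fF 0).
pose M0 := (Num.truncn (h%:R * F / eps)).+1; exists M0 => M hM.
rewrite subr0 /Lpart (@big_cat_nat _ _ _ M) //= ?leq_addr // addrC addrK.
have Mn0 : (0 < M)%N by rewrite (leq_trans _ hM).
have M1 : 0 < M%:R :> R by rewrite ltr0n.
apply: (le_trans (ler_norm_sum _ _ _)).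
apply: (@le_trans _ _ (\sum_(M <= m < M + h) F / M%:R)).
  rewrite big_nat [X in _ <= X]big_nat; apply: ler_sum => m /andP[Mm _].
  rewrite normrM normfV normrX normr_nat ler_pM ?invr_ge0 ?exprn_ge0 //.
  rewrite lef_pV2 ?posrE ?exprn_gt0 ?ltr0n //.
  apply: (@le_trans _ _ m.+1%:R); first by rewrite ler_nat leqW.
  by rewrite -natrX ler_nat -{1}(expn1 m.+1) leq_pexp2l.
rewrite sumr_const_nat addnC addnK -[_ *+ h]mulr_natl mulrA ler_pdivrMr //.
have /andP[_ lt] := truncn_itv (divr_ge0 (mulr_ge0 (ler0n R h) F0) (ltW e0)).
have : h%:R * F / eps < M%:R by apply: (lt_le_trans lt); rewrite ler_nat.
by rewrite ltr_pdivrMr // mulrC [eps * _]mulrC => /ltW; rewrite mulrC.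
Qed.

End Tends.

(** * Small forms with integer coefficients *)

Section SmallForm.
Variables (R : archiRealFieldType) (n k r b T D d p Q0 : nat) (f : int -> R) (F : R)
  (J : finType) (e : J -> nat) (w : J -> int) (theta : 'I_d -> R) (Lf : nat -> R)
  (A : nat -> 'I_d -> int) (c : nat).
Let q := (D * T)%N.
Hypotheses (n0 : (0 < n)%N) (c0 : (0 < c)%N) (cq : (c <= q)%N) (qk : (q <= k)%N) (qn : (q <= n)%N).
Hypotheses (krq : k = (r * q)%N) (r2 : (2 <= r)%N) (hb : (2 * (64 * k) ^ (12 * k) <= 2 ^ b)%N).
Hypotheses (T0 : (0 < T)%N) (D0 : (0 < D)%N) (fF : forall x, `|f x| <= F)
  (fT : forall x : int, f (x + T%:Z) = f x) (eD : forall i, (e i %| D)%N).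
Hypotheses (b_odd : odd b) (np : odd n.+1 = odd p).

(** The factor that the weighted sum puts on [L(f, s)], next to the sum of the partial fraction
    coefficients of order [s]. It is independent of [n], so one choice of [w] eliminates the same
    values for all [n]. *)
Definition weight (s : nat) : int := \sum_i w i * ((D * T) %/ e i)%N%:Z ^+ s.

Hypotheses (Lf_lim : forall s, (2 <= s)%N -> tends (Lpart f s) (Lf s))
  (weight1 : weight 1 = 0)
  (rel : forall s, (2 <= s <= b)%N -> odd s = odd p -> weight s != 0 ->
     Q0%:R * Lf s = \sum_l (A s l)%:~R * theta l).

Let x0 : R := (c + k * n)%:R / q%:R.
Let low : R := (n`!%:R / polar n x0) ^+ b.
Let L : R := (lcmto n)%:R.

Let q0 : (0 < q)%N. Proof. by rewrite muln_gt0 D0. Qed.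
Let e_gt0 i : (0 < e i)%N. Proof. by rewrite (dvdn_gt0 D0). Qed.
Let F0 : 0 <= F. Proof. exact: le_trans (fF 0). Qed.
Let b0 : (0 < b)%N. Proof. by case: (b) b_odd. Qed.
Let Sb : (size (starts n q k c) <= b)%N.
Proof.
apply: leq_trans (size_starts_le n0 c0 cq qk qn) _.
have := exponent_ge (leq_trans q0 qk) hb; clear; lia.
Qed.

(** The bound of [Rfun_pfr] with [(32 k) ^ (12 k n)] replaced by a second [2 ^ (n b)]; the leading 2
    is the doubling in [pfr_sym]. *)
Definition coef_bound : R := 2 * (b`!%:R * 2 ^+ (2 * n * b)).

Lemma partial_fraction_coefs : exists cf : nat -> nat -> R,
  [/\ forall i j, (i < b)%N -> L ^+ (b - i.+1) * cf i j \is a Num.int,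
      \sum_(i < b) \sum_(j < n.+1) `|cf i j| <= coef_bound,
      forall x, nonpole n x -> 2 * Rfun n q k c b x = pfeval n b cf x &
      forall i, odd i.+1 != odd p -> \sum_(j < n.+1) cf i j = 0].
Proof.
have B := Rfun_pfr R n0 c0 cq qk qn b0 Sb.
have S (x : R) : nonpole n x -> Rfun n q k c b (- n%:R - x) = (-1) ^+ (n.+1 * b) * Rfun n q k c b x.
  by move=> _; apply: Rfun_refl.
have [cf [h1 h2 h3 h4]] := pfr_sym B S; exists cf; split=> //; last first.
  (* As [b] is odd and [n + 1] has the parity of [p], the sign [(-1) ^ ((n + 1) b)] is [(-1) ^ p]:
     exactly the orders [i + 1] of the other parity drop out. *)
  by move=> i ip; apply: h4; rewrite oddD oddM b_odd andbT np; move: ip => /=; case: (odd i); case: (odd p).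
apply: (le_trans h2); rewrite /coef_bound !ler_wpM2l //.
have -> : 2 ^+ (2 * n * b) = 2 ^+ (n * b) * 2 ^+ (n * b) :> R.
  by rewrite -exprD; congr (_ ^+ _); lia.
rewrite ler_wpM2l ?exprn_ge0 //.
have -> : (32 * k%:R) ^+ (n * (12 * k)) = ((32 * k%:R) ^+ (12 * k)) ^+ n :> R.
  by rewrite -exprM mulnC.
have -> : 2 ^+ (n * b) = (2 ^+ b) ^+ n :> R by rewrite -exprM mulnC.
apply: lerXn2r; rewrite ?nnegrE ?exprn_ge0 ?mulr_ge0 //.
have := hb; rewrite -(ler_nat R) !natrM !natrX natrM; apply: le_trans.
apply: (@le_trans _ _ ((64 * k%:R) ^+ (12 * k))).
  by apply: lerXn2r; rewrite ?nnegrE ?mulr_ge0 // ler_wpM2r // ler_nat.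
by rewrite ler_peMl ?exprn_ge0 ?mulr_ge0 // ler1n.
Qed.


Let Ni i := (q %/ e i)%N.

Let Ni_dvd i : (e i %| q)%N. Proof. exact: dvdn_mulr. Qed.

Let Ni_gt0 i : (0 < Ni i)%N.
Proof. by rewrite divn_gt0 // dvdn_leq. Qed.

Let Ni_le i : (Ni i <= q)%N. Proof. exact: leq_div. Qed.

Let T_Ni i : (T %| Ni i)%N.
Proof. by rewrite /Ni /q mulnC -muln_divA // dvdn_mulr. Qed.

Definition truncated_form (M : nat) : R := \sum_i (w i)%:~R *
  \sum_(0 <= m < M) f m.+1%:Z * (2 * Rfun n q k c b (m.+1%:R / (q %/ e i)%N%:R)).

Section WithCoefs.
Variable cf : nat -> nat -> R.
Hypotheses (cf_int : forall i j, (i < b)%N -> L ^+ (b - i.+1) * cf i j \is a Num.int)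
  (cf_le : \sum_(i < b) \sum_(j < n.+1) `|cf i j| <= coef_bound)
  (cfE : forall x, nonpole n x -> 2 * Rfun n q k c b x = pfeval n b cf x)
  (cf0 : forall i, odd i.+1 != odd p -> \sum_(j < n.+1) cf i j = 0).

Let rho s := \sum_(j < n.+1) cf s j.

Definition rational_part : R :=
  \sum_i (w i)%:~R * \sum_(mu < n * Ni i) f (- mu%:Z) * upper_part n b (Ni i) cf mu.

Lemma nonpole_pos (x : R) : 0 < x -> nonpole n x.
Proof. by move=> x0' j _; rewrite gt_eqF // ltr_wpDr. Qed.

(* [L(f, 1)] may diverge, but its coefficient [weight 1] is zero. *)
Lemma truncated_form_lim :
  tends truncated_form
    (\sum_(s < b) rho s * (weight s.+1)%:~R * (if weight s.+1 == 0 then 0 else Lf s.+1) -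
     rational_part).
Proof.
pose dl i (s j : nat) M := Lpart f s.+1 (M + j * Ni i) - Lpart f s.+1 M.
(* The pole [- j] involves the partial sum up to [M + j N_i]; cutting all of them at the common [M]
   leaves this remainder. *)
pose rem M := \sum_i \sum_(s < b) \sum_(j < n.+1)
  ((w i)%:~R * (cf s j * (Ni i)%:R ^+ s.+1)) * dl i s j M.
have rem0 : tends rem 0.
  have -> : 0 = \sum_(i : J) \sum_(s < b) \sum_(j < n.+1)
     ((w i)%:~R * (cf s j * (Ni i)%:R ^+ s.+1)) * 0 :> R.
    rewrite big1 // => i _; rewrite big1 // => s _; rewrite big1 // => j _; exact: mulr0.
  apply: tends_sum => i; apply: tends_sum => s; apply: tends_sum => j.
  apply: tends_scale; exact: (Lpart_shift _ fF).
have E M : truncated_form M = (\sum_(s < b) (rho s * (weight s.+1)%:~R) * Lpart f s.+1 M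
    + rem M) + (- rational_part).
  have -> : truncated_form M = \sum_i (w i)%:~R *
      (\sum_(s < b) \sum_(j < n.+1) cf s j * (Ni i)%:R ^+ s.+1 * Lpart f s.+1 (M + j * Ni i) -
       \sum_(mu < n * Ni i) f (- mu%:Z) * upper_part n b (Ni i) cf mu).
    apply: eq_bigr => i _; congr (_ * _).
    rewrite -(@linear_form R n b (Ni i) cf (Ni_gt0 i) T M f fT (T_Ni i)).
    apply: eq_bigr => m _; rewrite cfE //; apply: nonpole_pos.
    by rewrite divr_gt0 // ltr0n; exact: Ni_gt0.
  under eq_bigr do rewrite mulrBr.
  rewrite sumrB; congr (_ - _).
  have -> : \sum_(s < b) (rho s * (weight s.+1)%:~R) * Lpart f s.+1 M =
     \sum_i \sum_(s < b) \sum_(j < n.+1)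
       (w i)%:~R * (cf s j * (Ni i)%:R ^+ s.+1) * Lpart f s.+1 M.
    rewrite exchange_big /=; apply: eq_bigr => s _.
    move: (Lpart f s.+1 M) => y; rewrite [rho s * _]mulrC -mulrA.
    have -> : (weight s.+1)%:~R = \sum_i (w i)%:~R * (Ni i)%:R ^+ s.+1 :> R.
      by rewrite /weight rmorph_sum; apply: eq_bigr => i _; rewrite rmorphM rmorphXn.
    rewrite mulr_suml; apply: eq_bigr => i _; rewrite /rho mulr_suml mulr_sumr.
    by apply: eq_bigr => j _; ring.
  rewrite -big_split /=; apply: eq_bigr => i _; rewrite mulr_sumr -big_split /=.
  apply: eq_bigr => s _; rewrite mulr_sumr -big_split /=; apply: eq_bigr => j _.
  by rewrite /dl; ring.
apply: (tends_ext E); apply: tends_add; last exact: tends_cst.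
rewrite -[X in tends _ X]addr0; apply: tends_add rem0.
apply: tends_sum => s; case: eqP => [->|/eqP ws].
  by apply: (@tends_ext _ _ (fun=> 0)) => [M|]; rewrite !(mulr0, mul0r) //; exact: tends_cst.
apply: tends_scale; apply: Lf_lim; case: (nat_of_ord s) ws => //.
by rewrite weight1 eqxx.
Qed.

Let wsum : R := \sum_i `|(w i)%:~R|.

Let Lp : 0 <= L ^+ b. Proof. exact: exprn_ge0. Qed.

Let cb0 : 0 <= coef_bound.
Proof. by rewrite !mulr_ge0 ?exprn_ge0. Qed.

Lemma rho_int s : (s < b)%N -> L ^+ b * rho s \is a Num.int.
Proof.
move=> sb; rewrite mulr_sumr rpred_sum // => j _.
rewrite -(subnK sb) exprD mulrAC rpredM ?rpredX ?rpred_nat //; exact: cf_int.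
Qed.

(** The point [- mu / N_i] equals [- mu e_i / q] with [mu e_i < q n]; when it is not an integer it
    is thus one of the zeros at negative grid points. *)
Lemma upper_int i mu : (mu < n * Ni i)%N -> L ^+ b * upper_part n b (Ni i) cf mu \is a Num.int.
Proof.
move=> mul; apply: upper_part_int => // nd.
have muE : mu%:R / (Ni i)%:R = (mu * e i)%N%:R / q%:R :> R by rewrite (grid_point R T0 D0 eD).
rewrite -cfE; last first.
  move=> j _; apply: contra nd; rewrite addrC subr_eq0 => /eqP h.
  apply/dvdnP; exists j; apply/eqP; rewrite -(eqr_nat R) natrM h divfK //.
  by rewrite pnatr_eq0 -lt0n.
have mu0 : (0 < mu)%N by case: mu nd {mul muE}; rewrite ?dvdn0.
rewrite muE (Rfun_neg_zero R n0 c0 cq qk qn Sb) ?mulr0 // muln_gt0 mu0 e_gt0 /=.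
have : (mu * e i <= n * Ni i * e i)%N by rewrite leq_mul2r (ltnW mul) orbT.
by rewrite -mulnA /Ni divnK ?Ni_dvd // [(n * q)%N]mulnC.
Qed.

Lemma weight_le s : (s <= b)%N -> `|(weight s)%:~R| <= wsum * q%:R ^+ b.
Proof.
move=> sb; rewrite /weight rmorph_sum mulr_suml; apply: (le_trans (ler_norm_sum _ _ _)).
apply: ler_sum => i _; rewrite rmorphM rmorphXn /= -pmulrn normrM ler_wpM2l //.
rewrite normrX normr_nat; apply: (@le_trans _ _ (q%:R ^+ s)).
  by apply: lerXn2r; rewrite ?nnegrE // ler_nat; exact: Ni_le.
by rewrite ler_weXn2l // ler1n.
Qed.

Lemma rho_le s : (s < b)%N -> `|rho s| <= coef_bound.
Proof.
move=> sb; apply: le_trans cf_le; apply: (le_trans (ler_norm_sum _ _ _)).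
by rewrite [X in _ <= X](bigD1 (Ordinal sb)) //= ler_wpDr // sumr_ge0 // => i _; rewrite sumr_ge0.
Qed.

Definition theta_coef (l : 'I_d) : R := \sum_(s < b)
  if (weight s.+1 != 0) && (odd s.+1 == odd p) then
    L ^+ b * rho s * (weight s.+1)%:~R * (A s.+1 l)%:~R else 0.

(** Grouping [mu] by residues modulo [T] keeps the number of coordinates equal to [T] however large
    [n] is. *)
Definition value_coef (u : 'I_T) : R := - (Q0%:R * \sum_i (w i)%:~R *
  \sum_(mu < n * Ni i | (mu %% T == u)%N) L ^+ b * upper_part n b (Ni i) cf mu).

Lemma theta_coef_int l : theta_coef l \is a Num.int.
Proof.
apply: rpred_sum => s _; case: ifP => _; last exact: rpred0.
by apply: rpredM; [apply: rpredM; [exact: rho_int | exact: intr_int] | exact: intr_int].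
Qed.

Lemma value_coef_int u : value_coef u \is a Num.int.
Proof.
rewrite rpredN rpredM ?rpred_nat // rpred_sum // => i _.
by rewrite rpredM ?intr_int // rpred_sum // => mu _; apply: upper_int.
Qed.

Lemma theta_coef_le l (Am : R) : (forall s, (s <= b)%N -> `|(A s l)%:~R| <= Am) ->
  `|theta_coef l| <= b%:R * (wsum * q%:R ^+ b) * Am * (L ^+ b * coef_bound).
Proof.
move=> hA; have Am0 : 0 <= Am by apply: le_trans (hA 0 isT).
have w0 : 0 <= wsum by apply: sumr_ge0.
have t0 : 0 <= (wsum * q%:R ^+ b) * Am * (L ^+ b * coef_bound).
  by rewrite !mulr_ge0 // exprn_ge0.
apply: (le_trans (ler_norm_sum _ _ _)).
apply: (@le_trans _ _ (\sum_(s < b) (wsum * q%:R ^+ b) * Am * (L ^+ b * coef_bound))); last first.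
  rewrite sumr_const card_ord -[_ *+ b]mulr_natl le_eqVlt; apply/orP; left; apply/eqP; ring.
apply: ler_sum => s _; case: ifP => _; last by rewrite normr0.
rewrite !normrM [`|L ^+ b|]ger0_norm //.
rewrite [X in _ <= X](_ : _ = L ^+ b * coef_bound * (wsum * q%:R ^+ b) * Am); last by ring.
apply: ler_pM; rewrite ?mulr_ge0 //; last exact: hA.
apply: ler_pM; rewrite ?mulr_ge0 //; last exact: weight_le.
by rewrite ler_wpM2l // rho_le.
Qed.

Lemma value_coef_le u :
  `|value_coef u| <= Q0%:R * wsum * (n * q)%:R * q%:R ^+ b * (L ^+ b * coef_bound).
Proof.
rewrite normrN normrM normr_nat -!mulrA ler_wpM2l //.
rewrite /wsum mulr_suml; apply: (le_trans (ler_norm_sum _ _ _)); apply: ler_sum => i _.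
rewrite normrM ler_wpM2l //; apply: (le_trans (ler_norm_sum _ _ _)).
have t0 : 0 <= q%:R ^+ b * (L ^+ b * coef_bound) by rewrite mulr_ge0 ?exprn_ge0 // mulr_ge0.
apply: (@le_trans _ _ (\sum_(mu < n * Ni i) q%:R ^+ b * (L ^+ b * coef_bound))).
  rewrite big_mkcond; apply: ler_sum => mu _; case: ifP => _ //.
  rewrite normrM ger0_norm // mulrCA ler_wpM2l //.
  apply: (le_trans (upper_part_le (Ni_gt0 i) mu cf_le)); rewrite ler_wpM2r //.
  by apply: lerXn2r; rewrite ?nnegrE // ler_nat; exact: Ni_le.
rewrite sumr_const card_ord -[_ *+ _]mulr_natl ler_wpM2r // ler_nat leq_mul2l Ni_le orbT //.
Qed.

Lemma form_value :
  \sum_l theta_coef l * theta l + \sum_(u < T) value_coef u * f (- (u%:Z)) =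
  Q0%:R * (L ^+ b * (\sum_(s < b) rho s * (weight s.+1)%:~R *
     (if weight s.+1 == 0 then 0 else Lf s.+1) - rational_part)).
Proof.
rewrite !mulrBr; congr (_ + _).
  rewrite /theta_coef; under eq_bigr do rewrite mulr_suml.
  rewrite exchange_big !mulr_sumr /=; apply: eq_bigr => s _.
  case: eqP => [->|/eqP ws] /=.
    by rewrite !mulr0 big1 // => l _; rewrite mul0r.
  case: eqP => [sp|/eqP sp]; last first.
    have -> : rho s = 0 by apply: cf0.
    by rewrite !mul0r !mulr0 big1 // => l _; rewrite mul0r.
  have s2 : (2 <= s.+1 <= b)%N.
    rewrite ltn_ord andbT; by case: (nat_of_ord s) ws => //; rewrite weight1 eqxx.
  rewrite (_ : Q0%:R * _ = L ^+ b * rho s * (weight s.+1)%:~R * (Q0%:R * Lf s.+1)); last by ring.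
  rewrite rel //; move: (rho s) (L ^+ b) => x y.
  by rewrite mulr_sumr; apply: eq_bigr => l _; rewrite mulrA.
have fmod (mu : nat) : f (- mu%:Z) = f (- (mu %% T)%N%:Z).
  rewrite -[in RHS](periodicM fT _ 0) -(periodicM fT _ (mu %/ T)); congr f.
  by rewrite mul0n addr0 {1}(divn_eq mu T) PoszD; ring.
have E (u : 'I_T) : value_coef u * f (- (u%:Z)) = - (Q0%:R * \sum_i (w i)%:~R *
    \sum_(mu < n * Ni i | (mu %% T == u)%N) L ^+ b * (f (- mu%:Z) * upper_part n b (Ni i) cf mu)).
  rewrite /value_coef mulNr -mulrA; congr (- (_ * _)); rewrite mulr_suml; apply: eq_bigr => i _.
  rewrite -mulrA; congr (_ * _); rewrite mulr_suml; apply: eq_bigr => mu /eqP muu.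
  by rewrite (fmod mu) muu -mulrA [upper_part _ _ _ _ _ * _]mulrC.
rewrite (eq_bigr _ (fun u _ => E u)) sumrN -mulr_sumr; congr (- (_ * _)).
rewrite exchange_big /rational_part mulr_sumr; apply: eq_bigr => i _.
rewrite -mulr_sumr mulrCA; congr (_ * _).
pose h (mu : 'I_(n * Ni i)) : 'I_T := Ordinal (ltn_pmod mu T0).
rewrite [X in _ * X](partition_big h xpredT) //= mulr_sumr; apply: eq_bigr => u _.
by rewrite mulr_sumr; apply: eq_bigl => mu; rewrite -val_eqE.
Qed.

End WithCoefs.

(** The factor [Q0 L ^ b] makes all coefficients integers, and the estimate of the truncated sums
    passes to the limit. *)
Lemma small_form (Am : R) : (forall s l, (s <= b)%N -> `|(A s l)%:~R| <= Am) ->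
  exists (l : 'I_d -> int) (l' : 'I_T -> int),
  [/\ forall j, `|(l j)%:~R| <= b%:R * ((\sum_i `|(w i)%:~R|) * q%:R ^+ b) * Am * (L ^+ b * coef_bound),
      forall j, `|(l' j)%:~R| <=
        Q0%:R * (\sum_i `|(w i)%:~R|) * (n * q)%:R * q%:R ^+ b * (L ^+ b * coef_bound) &
      `|\sum_j (l j)%:~R * theta j + \sum_(u < T) (l' u)%:~R * f (- (u%:Z)) -
        Q0%:R * (L ^+ b * (convolution f e w c * (2 * Rfun n q k c b x0)))| <=
      Q0%:R * (L ^+ b * ((\sum_i `|(w i)%:~R|) *
        (4 * F * (2 ^- n * (4 * k%:R * n%:R) ^+ 2) * low)))].
Proof.
move=> hA; have [cf [h1 h2 h3 h4]] := partial_fraction_coefs.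
exists (fun j => Num.floor (theta_coef cf j)), (fun u => Num.floor (value_coef cf u)).
have E1 j : (Num.floor (theta_coef cf j))%:~R = theta_coef cf j.
  by apply/eqP; rewrite -intrEfloor theta_coef_int.
have E2 u : (Num.floor (value_coef cf u))%:~R = value_coef cf u.
  by apply/eqP; rewrite -intrEfloor value_coef_int.
split.
- by move=> j; rewrite E1; apply: theta_coef_le => // s; apply: hA.
- by move=> u; rewrite E2; apply: value_coef_le.
rewrite (eq_bigr _ (fun j _ => congr1 (fun x => x * theta j) (E1 j))).
rewrite (eq_bigr _ (fun u _ => congr1 (fun x => x * f (- (nat_of_ord u)%:Z)) (E2 u))).
rewrite form_value // -mulrBr -mulrBr !normrM normr_nat ler_wpM2l // [`|L ^+ b|]ger0_norm ?exprn_ge0 //.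
rewrite ler_wpM2l ?exprn_ge0 //.
apply: (tends_bound (truncated_form_lim h3)) => M hM.
(* Since [q] divides [k], the nonzero weight at the sample point is the same for every [n]. *)
have cE : convolution f e w (c + k * n) = convolution f e w c.
  by rewrite krq mulnAC (convolution_periodic w fT eD).
by have := main_sum w n0 c0 cq qk qn krq r2 hb T0 D0 fF eD hM; rewrite cE.
Qed.

End SmallForm.

(** * Asymptotic comparison and the contradiction *)

Lemma poly_le_exp2 (R : archiRealFieldType) (K : R) (m : nat) :
  exists n1 : nat, forall n, (n1 <= n)%N -> K * n%:R ^+ m <= 2 ^+ n.
Proof.
pose C : R := (m.+1`! * 2 ^ m.+1)%N%:R.
have C0 : 0 <= C by [].
exists (Num.truncn (`|K| * C)).+1 => n hn.
have n0 : (0 < n)%N by apply: leq_trans hn.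
have nr : 0 < n%:R :> R by rewrite ltr0n.
have KC : `|K| * C <= n%:R.
  have /andP[_ lt] := truncn_itv (mulr_ge0 (normr_ge0 K) C0).
  by apply: (le_trans (ltW lt)); rewrite ler_nat.
have h : n%:R ^+ m.+1 <= C * 2 ^+ n :> R.
  by rewrite /C -!natrX -natrM ler_nat expn_le_exp2.
apply: (@le_trans _ _ (`|K| * n%:R ^+ m)).
  by rewrite ler_wpM2r ?exprn_ge0 // ler_norm.
rewrite -(ler_pM2r nr) -mulrA -exprSr; apply: (@le_trans _ _ (`|K| * (C * 2 ^+ n))).
  by rewrite ler_wpM2l.
by rewrite mulrA mulrC ler_wpM2l ?exprn_ge0.
Qed.

Lemma periodic_bounded (R : realFieldType) (T : nat) (f : int -> R) : (0 < T)%N ->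
  (forall x : int, f (x + T%:Z) = f x) -> exists F : R, forall x, `|f x| <= F.
Proof.
move=> T0 fT; exists (\sum_(i < T) `|f i%:Z|) => x.
have [m mT ->] : exists2 m, (m < T)%N & f x = f m%:Z.
  have Tz : T%:Z != 0 by case: (T) T0.
  exists `|(x %% T%:Z)%Z|%N.
    by rewrite -ltz_nat gez0_abs ?modz_ge0 // ltz_pmod.
  rewrite gez0_abs ?modz_ge0 // {1}(divz_eq x T%:Z) addrC; case: (divz x T%:Z) => h.
    by rewrite -PoszM (periodicM fT).
  rewrite -[LHS](periodicM fT _ h.+1); congr f; rewrite NegzE PoszM; ring.
by rewrite (bigD1 (Ordinal mT)) //= lerDl sumr_ge0.
Qed.

(** Base 2 exponents in the lower bound for the form. [g - 6 + 11] is the [A + v] of the criterion,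
    and [g + 4 <= nu] absorbs the excess of [n] over [2 nu]. *)
Lemma exponent_lower g n b nu : (0 < b)%N -> (6 <= g)%N -> (n <= 2 * nu + 2)%N ->
  (g + 4 <= nu)%N -> (n + (g + 3) * n * b <= 2 * b * ((g - 6 + 11) * nu))%N.
Proof.
move=> b0 g6 hn hg.
have h1 : (n <= n * b)%N by rewrite leq_pmulr.
have h2 : (n * b * (g + 4) <= (2 * nu + 2) * b * (g + 4))%N by rewrite leq_mul2r leq_mul2r hn !orbT.
have h3 : (b * ((2 * nu + 2) * (g + 4)) <= b * (2 * ((g - 6 + 11) * nu)))%N.
  rewrite leq_mul2l; apply/orP; right; rewrite (_ : g - 6 + 11 = g + 5)%N; nia.
move: h1 h2 h3; clear; lia.
Qed.

(** Base 2 exponents in the upper bound for the form: [4 n b] pays for [lcmto n ^ b], [b n] for the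
    zeros of [R], and [n] for the constants. *)
Lemma exponent_upper g n b nu : (0 < b)%N -> (6 <= g)%N -> (2 * nu <= n)%N ->
  (2 * b * ((g - 6) * nu) + (n + 4 * n * b + b * n) <= g * (b * n))%N.
Proof.
move=> b0 g6 hn.
have h1 : (n <= n * b)%N by rewrite leq_pmulr.
have h2 : (b * (g - 6) * (2 * nu) <= b * (g - 6) * n)%N by rewrite leq_mul2l hn orbT.
have h3 : (b * (g - 6) * n + 6 * (n * b) = g * (b * n))%N.
  by rewrite -{2}(subnK g6); ring.
move: h1 h2 h3; clear; lia.
Qed.

(* With [X = 2 ^ b], the forms attached to [n] have coefficients at most
   [X ^ (7 n)] and values between [X ^ (- (g + 4) n)] and [X ^ (- (g - 6) n)];
   as the parity of [n] is prescribed, the criterion is applied along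
   [n = 2 nu + 1 + p]. *)
Lemma no_dependence (R : archiRealFieldType) (k b T D d p Q0 g : nat)
  (f : int -> R) (J : finType) (e : J -> nat) (w : J -> int) (theta : 'I_d -> R)
  (Lf : nat -> R) (A : nat -> 'I_d -> int) :
  (0 < T)%N -> (0 < D)%N -> k = (2 ^ g * (D * T))%N ->
  (20 * (d + T) + 6 <= g)%N -> (2 * (64 * k) ^ (12 * k) <= 2 ^ b)%N ->
  odd b -> (p <= 1)%N -> (0 < Q0)%N ->
  (forall x : int, f (x + T%:Z) = f x) -> (exists x, f x != 0) ->
  injective e -> (forall i, (e i %| D)%N) -> (exists i, w i != 0) ->
  (forall s, (2 <= s)%N -> tends (Lpart f s) (Lf s)) ->
  weight T D e w 1 = 0 ->
  ~ (forall s, (2 <= s <= b)%N -> odd s = odd p -> weight T D e w s != 0 ->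
     Q0%:R * Lf s = \sum_l (A s l)%:~R * theta l).
Proof.
move=> T0 D0 kE hg hb b_odd p1 Q1 fT fnz e_inj eD wnz Lf_lim w1 rel.
have [c /andP[c0 cq] cnz] := convolution_neq0 T0 D0 fT e_inj eD fnz wnz.
pose q := (D * T)%N.
have q0 : (0 < q)%N by rewrite muln_gt0 D0.
have g1 : (1 <= g)%N by apply: leq_trans hg; rewrite addnS.
have r2 : (2 <= 2 ^ g)%N by rewrite -{1}(expn1 2) leq_exp2l.
have qk : (q <= k)%N by rewrite kE leq_pmull // expn_gt0.
have b0 : (0 < b)%N by case: (b) b_odd.
have [F fF] := periodic_bounded T0 fT.
have F0 : 0 <= F by apply: le_trans (fF 0).
have [Am hA] : exists Am : R, forall s l, (s <= b)%N -> `|(A s l)%:~R| <= Am.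
  exists (\sum_(s < b.+1) \sum_l `|(A s l)%:~R|) => s l sb.
  rewrite -ltnS in sb; rewrite (bigD1 (Ordinal sb)) //= (bigD1 l) //= -addrA lerDl.
  by rewrite addr_ge0 // sumr_ge0 // => *; rewrite sumr_ge0.
pose W : R := \sum_i `|(w i)%:~R|.
pose a : R := `|convolution f e w c|.
have a0 : 0 < a by rewrite normr_gt0.
have W0 : 0 <= W by apply: sumr_ge0.
have Am0 : 0 <= `|Am| by [].
pose K1 : R := (b%:R * (W * q%:R ^+ b) * `|Am| + Q0%:R * W * q%:R * q%:R ^+ b) * (2 * b`!%:R).
have [n1 hn1] := poly_le_exp2 K1 1.
have [n2 hn2] := poly_le_exp2 (a^-1 * (W * (4 * F * (4 * k%:R) ^+ 2))) 2.
have [n3 hn3] := poly_le_exp2 (a^-1 * (2 ^ g + 2)%:R ^+ b) b.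
have [n4 hn4] := poly_le_exp2 (3 * Q0%:R * a : R) 0.
(* The point to which the criterion is applied: the given family followed by the values [f(- u)],
   [u < T]. *)
pose th (j : 'I_(d + T)) : R :=
  match fintype.split j with inl l => theta l | inr u => f (- (nat_of_ord u)%:Z) end.
have Y1 : 1 < 2 ^+ (2 * b) :> R by rewrite exprn_egt1 ?ltr1n //; lia.
pose nu0 := (n1 + n2 + n3 + n4 + q + g + 7)%N.
(* The index is [nu] with [n] about [2 nu], hence [X = 2 ^ (2 b)]. Coefficients up to [2 ^ (7 n b)]
   give [u = 8] once [nu >= 7]; [u + v + 1 = 20] is the 20 in the hypothesis on [g]. *)
apply: (@nesterenko_criterion R (d + T) th (2 ^+ (2 * b)) 8 11 (g - 6) nu0 Y1).
- by rewrite addn_gt0 T0 orbT.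
- by move: hg; clear; lia.
move=> nu hnu; have [n nE] : exists n, n = (2 * nu + 1 + p)%N by exists (2 * nu + 1 + p)%N.
have [n0 qn [nn1 nn2 nn3 nn4] [nl nu7 nug nle]] : [/\ (0 < n)%N, (q <= n)%N,
    [/\ n1 <= n, n2 <= n, n3 <= n & n4 <= n]%N &
    [/\ 2 * nu <= n, 7 <= nu, g + 4 <= nu & n <= 2 * nu + 2]%N].
  by move: hnu p1; rewrite /nu0 nE; move: (n1) (n2) (n3) (n4) (q); clear;
    split; [lia|lia|split; lia|split; lia].
have np : odd n.+1 = odd p.
  have -> : n.+1 = (nu.+1.*2 + p)%N by rewrite nE; clear; lia.
  by rewrite oddD odd_double.
have := small_form (Q0 := Q0) n0 c0 cq qk qn kE r2 hb T0 D0 fF fT eD b_odd np Lf_lim w1 rel.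
move=> /(_ _ hA) [l [l' [hl hl' hform]]].
exists (fun j => match fintype.split j with inl i => l i | inr u => l' u end).
set L : R := (lcmto n)%:R in hl hl' hform.
have L1 : 1 <= L by rewrite ler1n lcmto_gt0.
have L0 : 0 <= L by [].
have Lb1 : 1 <= L ^+ b by rewrite exprn_ege1.
have Lb : L ^+ b <= 2 ^+ (4 * n * b).
  have : L <= 2 ^+ (4 * n) by rewrite -natrX ler_nat expnM lcmto_le.
  by move=> h; rewrite [X in _ <= X]exprM; apply: lerXn2r; rewrite ?nnegrE ?exprn_ge0.
have two_n : 2 ^+ n <= 2 ^+ (n * b) :> R by rewrite ler_weXn2l ?ler1n // leq_pmulr.
have Lcb : L ^+ b * coef_bound R n b <= 2 * b`!%:R * 2 ^+ (6 * n * b).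
  apply: (@le_trans _ _ (2 ^+ (4 * n * b) * coef_bound R n b)).
    by rewrite ler_wpM2r // /coef_bound !mulr_ge0 ?exprn_ge0.
  have -> : (6 * n * b = 4 * n * b + 2 * n * b)%N by rewrite -!mulnDl.
  by rewrite exprD /coef_bound le_eqVlt; apply/orP; left; apply/eqP; ring.
have cb0 : 0 <= L ^+ b * coef_bound R n b.
  by rewrite mulr_ge0 ?exprn_ge0 // /coef_bound !mulr_ge0 ?exprn_ge0.
have n1r : 1 <= n%:R :> R by rewrite ler1n.
have coef_final (x : R) : x <= K1 / (2 * b`!%:R) * n%:R * (L ^+ b * coef_bound R n b) ->
    x <= (2 ^+ (2 * b)) ^+ (8 * nu).
  have f0 : 0 < b`!%:R :> R by rewrite ltr0n fact_gt0.
  move/le_trans; apply.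
  have k0 : 0 <= K1 / (2 * b`!%:R) * n%:R.
    by rewrite mulr_ge0 // mulfK ?mulf_neq0 ?gt_eqF // addr_ge0 // !mulr_ge0 ?exprn_ge0.
  apply: (le_trans (ler_wpM2l k0 Lcb)).
  have -> : K1 / (2 * b`!%:R) * n%:R * (2 * b`!%:R * 2 ^+ (6 * n * b)) = K1 * n%:R ^+ 1 * 2 ^+ (6 * n * b).
    by rewrite expr1; field; rewrite gt_eqF.
  apply: (@le_trans _ _ (2 ^+ n * 2 ^+ (6 * n * b))); first by rewrite ler_wpM2r ?exprn_ge0 ?hn1.
  rewrite -exprD -exprM ler_weXn2l ?ler1n //.
  move: nle nu7 b0; clear; nia.
have Am1 : Am <= `|Am| by apply: ler_norm.
have f0 : 0 < b`!%:R :> R by rewrite ltr0n fact_gt0.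
have sumK : K1 / (2 * b`!%:R) = b%:R * (W * q%:R ^+ b) * `|Am| + Q0%:R * W * q%:R * q%:R ^+ b.
  by rewrite /K1 mulfK // mulf_neq0 // gt_eqF.
have t1 : 0 <= b%:R * (W * q%:R ^+ b) * `|Am| by rewrite !mulr_ge0 ?exprn_ge0.
have t2 : 0 <= Q0%:R * W * q%:R * q%:R ^+ b by rewrite !mulr_ge0 ?exprn_ge0.
split.
  move=> j; case: (fintype.split j) => i; apply: coef_final; rewrite sumK.
    apply: (le_trans (hl i)); apply: ler_wpM2r cb0 _ _ _.
    apply: (@le_trans _ _ (b%:R * (W * q%:R ^+ b) * `|Am|)).
      by rewrite ler_wpM2l // !mulr_ge0 ?exprn_ge0.
    apply: (@le_trans _ _ (b%:R * (W * q%:R ^+ b) * `|Am| + Q0%:R * W * q%:R * q%:R ^+ b)).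
      by rewrite lerDl.
    by rewrite ler_peMr // addr_ge0.
  apply: (le_trans (hl' i)); apply: ler_wpM2r cb0 _ _ _.
  rewrite [X in X <= _](_ : _ = Q0%:R * W * q%:R * q%:R ^+ b * n%:R); last first.
    by rewrite -/W -/q natrM; move: (W) (q%:R : R) (n%:R : R) (Q0%:R : R) => y z x u; ring.
  by rewrite mulrDl lerDr mulr_ge0.
rewrite big_split_ord /=.
rewrite (eq_bigr (fun j => (l j)%:~R * theta j)) => [|j _]; last first.
  by rewrite /th (unsplitK (inl j)).
rewrite [X in _ + X](eq_bigr (fun u => (l' u)%:~R * f (- (nat_of_ord u)%:Z))) => [|u _]; last first.
  by rewrite /th (unsplitK (inr u)).
move: hform; set Lam := \sum_(j < d) _ + \sum_(u < T) _.
pose x0 : R := (c + k * n)%:R / (D * T)%:R; rewrite -/x0.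
pose Rv := Rfun n q k c b x0; rewrite -/Rv.
pose low := (n`!%:R / polar n x0) ^+ b; rewrite -/low => hform.
have low_R : low <= `|Rv| := Rfun_main_ge R n0 c0 cq qk qn kE r2 hb.
have R_le : `|Rv| <= (2 / (2 ^ g)%:R) ^+ (b * n) := Rfun_main_le R n0 c0 cq qk qn kE r2 hb.
have low_g := low_ge R n0 c0 cq qk qn kE r2 hb; rewrite -/x0 -/low in low_g.
have rn0 : 0 < (2 ^ g + 2)%:R * n%:R :> R by rewrite -natrM ltr0n muln_gt0 n0 addn2.
have low0 : 0 <= low.
  apply: le_trans low_g; rewrite invr_ge0; apply: exprn_ge0; apply: mulr_ge0; first exact: ltW.
  by apply: exprn_ge0; apply: mulr_ge0.
pose E : R := Q0%:R * L ^+ b.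
have E1 : 1 <= E by rewrite -[1]mulr1 ler_pM // ler1n.
(* By the choice of [n2] and [low <= |Rv|], the error is at most half of the main term, whence
   [E a |Rv| <= |Lam| <= 3 E a |Rv|]. *)
have err : `|Lam - E * (convolution f e w c * (2 * Rv))| <= E * (a * low).
  rewrite /E -[X in _ - X]mulrA -[X in _ <= X]mulrA. apply: (le_trans hform).
  apply: ler_wpM2l => //; apply: ler_wpM2l; first exact: exprn_ge0.
  rewrite mulrA; apply: ler_wpM2r => //; rewrite -/W.
  have h : W * (4 * F * (4 * k%:R) ^+ 2) * n%:R ^+ 2 <= a * 2 ^+ n.
    by rewrite -ler_pdivrMl //; have := hn2 n nn2; rewrite -[X in X <= _ -> _]mulrA.
  rewrite [X in X <= _](_ : _ = W * (4 * F * (4 * k%:R) ^+ 2) * n%:R ^+ 2 / 2 ^+ n); last first.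
    by rewrite exprMn; move: (2 ^- n) => y; ring.
  by rewrite ler_pdivrMr ?exprn_gt0.
have main : `|E * (convolution f e w c * (2 * Rv))| = 2 * (E * (a * `|Rv|)).
  have Eg : `|E| = E by apply: ger0_norm; exact: (le_trans ler01 E1).
  by rewrite normrM Eg normrM normrM -/a normr_nat; ring.
have aR : E * (a * low) <= E * (a * `|Rv|).
  by rewrite !ler_wpM2l // ?(ltW a0) // (le_trans ler01 E1).
apply/andP; split.
  apply: (@le_trans _ _ (a * low)); last first.
    apply: (@le_trans _ _ (E * (a * low))); first by rewrite ler_peMl // mulr_ge0 // ltW.
    have := ler_normB Lam (Lam - E * (convolution f e w c * (2 * Rv))).
    by rewrite subKr main; lra.
  apply: (@le_trans _ _ (a * ((2 ^ g + 2)%:R * n%:R * (4 * (2 ^ g + 2)%:R) ^+ n) ^- b)); last first.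
    by rewrite ler_wpM2l // ltW.
  have h3 := hn3 n nn3; rewrite -mulrA ler_pdivrMl // -exprMn in h3.
  have h5 : (4 * (2 ^ g + 2)%:R) ^+ n <= 2 ^+ ((g + 3) * n) :> R.
    rewrite exprM; apply: lerXn2r; rewrite ?nnegrE ?mulr_ge0 ?exprn_ge0 //.
    by rewrite -natrX -natrM ler_nat expnD; move: r2; clear; lia.
  rewrite ler_pdivlMr; last by rewrite exprn_gt0 // mulr_gt0 // exprn_gt0 // mulr_gt0 // ltr0n addn2.
  rewrite mulrC ler_pdivrMr ?exprn_gt0 // exprMn.
  apply: (@le_trans _ _ ((a * 2 ^+ n) * 2 ^+ ((g + 3) * n * b))).
    apply: ler_pM => //; rewrite ?exprn_ge0 ?mulr_ge0 ?(ltW rn0) //.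
    rewrite [X in _ <= X]exprM; apply: lerXn2r; rewrite ?nnegrE ?mulr_ge0 ?exprn_ge0 ?mulr_ge0 //.
  rewrite -mulrA ler_wpM2l ?(ltW a0) // -exprD -exprM ler_weXn2l ?ler1n //.
  apply: exponent_lower => //; exact: leq_trans (leq_addl _ _) hg.
apply: (@le_trans _ _ (3 * (E * (a * `|Rv|)))).
  have := ler_normD (Lam - E * (convolution f e w c * (2 * Rv))) (E * (convolution f e w c * (2 * Rv))).
  by rewrite subrK main; lra.
have h4 := hn4 n nn4; rewrite expr0 mulr1 in h4.
have -> : 3 * (E * (a * `|Rv|)) = 3 * Q0%:R * a * (L ^+ b * `|Rv|) by rewrite /E; ring.
apply: (@le_trans _ _ (2 ^+ n * (2 ^+ (4 * n * b) * (2 / (2 ^ g)%:R) ^+ (b * n)))).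
  apply: ler_pM; [| |exact: h4|].
  - by rewrite !mulr_ge0 // ltW.
  - by rewrite mulr_ge0 ?exprn_ge0.
  - by apply: ler_pM; rewrite ?exprn_ge0.
rewrite expr_div_n natrX -!exprM !mulrA ler_pdivrMr ?exprn_gt0 //.
rewrite ler_pdivlMl ?exprn_gt0 // -!exprD ler_weXn2l ?ler1n //.
apply: exponent_upper => //; exact: leq_trans (leq_addl _ _) hg.
Qed.

(** * An integer with many divisors *)

Section LogEstimates.
Variable R : realType.

Lemma expR_ge_sqr (x : R) : 0 <= x -> x ^+ 2 / 4 <= expR x.
Proof.
move=> x0; have -> : expR x = expR (x / 2) ^+ 2 by rewrite -expRM_natl; congr expR; field.
have -> : x ^+ 2 / 4 = (x / 2) ^+ 2 by rewrite expr_div_n; congr (_ / _); ring.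
apply: lerXn2r; rewrite ?nnegrE ?expR_ge0 ?divr_ge0 //.
by have := expR_ge1Dx (x / 2); lra.
Qed.

Lemma ln2_ge : 2^-1 <= ln (2 : R).
Proof.
have : ln (1 + - (2^-1)) <= - (2^-1) :> R by apply: le_ln1Dx; lra.
have -> : 1 + - 2^-1 = 2^-1 :> R by lra.
by rewrite lnV ?posrE // lerN2.
Qed.

Lemma ln2_le1 : ln (2 : R) <= 1.
Proof. by have := @le_ln1Dx R 1; rewrite (_ : 1 + 1 = 2) //; apply; lra. Qed.

(** To be read with [y = log log a] and [expR y = log a]. The first inequality bounds the logarithm
    of a product of about [(1 - eps) log a / log log a] primes, each at most about [4 log a]; the
    second makes [12 k log (64 k)] at most [a / 4]. *)
Lemma growth_estimates (eps C y : R) : 0 < eps -> eps <= 1 -> 1 <= C ->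
  64 / eps + 9 + 128 * C / eps ^+ 2 <= y ->
  ((1 - eps) * (expR y / y) + 3) * (y + 3) <= (1 - eps / 2) * expR y /\
  C * (C + expR y) * expR (- (eps / 2 * expR y)) <= 1 / 4.
Proof.
move=> e0 e1 C1 hy.
have t1 : 0 < 64 / eps by rewrite divr_gt0.
have t2 : 0 < 128 * C / eps ^+ 2 by rewrite divr_gt0 ?exprn_gt0 //; lra.
have y0 : 0 < y by lra.
have := expR_ge1Dx y; have := expR_ge_sqr (ltW y0); have := expR_gt0 y.
move: (expR y) => x x0 xy xy1.
have ey : 64 <= eps * y.
  have : 64 / eps <= y by lra.
  by rewrite ler_pdivrMr // mulrC.
have eC : 128 * C <= eps ^+ 2 * x.
  have : 128 * C / eps ^+ 2 <= x by lra.
  by rewrite ler_pdivrMr ?exprn_gt0 // [x * _]mulrC.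
split.
  have -> : ((1 - eps) * (x / y) + 3) * (y + 3) = (1 - eps) * x + 3 * ((1 - eps) * (x / y)) + 3 * y + 9.
    by field; rewrite gt_eqF.
  have h1 : 3 * ((1 - eps) * (x / y)) <= eps * x / 4.
    apply: (@le_trans _ _ (3 * (x / y))).
      rewrite ler_wpM2l // ler_piMl ?divr_ge0 ?(ltW x0) ?(ltW y0) //; lra.
    rewrite mulrA ler_pdivrMr //; have : 64 * x <= eps * y * x by rewrite ler_wpM2r // ltW.
    by lra.
  have h2 : 3 * y + 9 <= eps * x / 4.
    have : eps * (y ^+ 2 / 4) <= eps * x by rewrite ler_wpM2l // ltW.
    have : 64 * y <= eps * y * y by rewrite ler_wpM2r // ltW.
    by rewrite expr2; lra.
  by lra.
have z0 : 0 <= eps / 2 * x by rewrite mulr_ge0 ?divr_ge0 // ltW.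
rewrite expRN ler_pdivrMr ?expR_gt0 //.
apply: (@le_trans _ _ (1 / 4 * ((eps / 2 * x) ^+ 2 / 4))); last first.
  by rewrite ler_wpM2l ?divr_ge0 // expR_ge_sqr.
have Cx : C <= x.
  have : eps ^+ 2 * x <= 1 * x by rewrite ler_wpM2r ?(ltW x0) // expr_le1 // ltW.
  lra.
apply: (@le_trans _ _ (2 * C * x)).
  have : C * (C + x) <= C * (x + x) by rewrite ler_wpM2l //; lra.
  lra.
have : 128 * C * x <= eps ^+ 2 * x * x by rewrite ler_wpM2r // ltW.
by rewrite !exprMn exprVn !expr2; lra.
Qed.

(** The surplus factor 4 leaves room to eliminate [s = 1] too; the exponent [a - 1] allows for
    passing to an odd number. *)
Lemma many_divisors (eps : R) (G : nat) : 0 < eps -> eps <= 1 -> (0 < G)%N ->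
  exists a0 : nat, forall a, (a0 <= a)%N -> exists P : seq nat,
  [/\ uniq P, all prime P,
      4 * 2 `^ ((1 - eps) * (ln (a%:R : R) / ln (ln (a%:R : R)))) <= 2 ^+ size P &
      (2 * (64 * (G * \prod_(i <- P) i)) ^ (12 * (G * \prod_(i <- P) i)) <= 2 ^ a.-1)%N].
Proof.
move=> e0 e1 G0.
have aux (e' x' n1 n2 n3 : R) : n1 * 2^-1 <= n3 -> 0 <= e' * x' -> n3 <= n2 ->
  n2 <= (1 - e' / 2) * x' -> 2 * x' < n1 -> False by lra.
pose C : R := 64 * G%:R.
have G1 : 1 <= G%:R :> R by rewrite ler1n.
have C1 : 1 <= C by rewrite /C; lra.
pose Y := 64 / eps + 9 + 128 * C / eps ^+ 2.
have Y9 : 9 <= Y.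
  have : 0 < 64 / eps by rewrite divr_gt0.
  have : 0 < 128 * C / eps ^+ 2 by rewrite divr_gt0 ?exprn_gt0 //; lra.
  by rewrite /Y; lra.
exists (Num.truncn (expR (expR Y))).+1 => a ha.
have aY : expR (expR Y) <= a%:R.
  have /andP[_ lt] := truncn_itv (expR_ge0 (expR Y)).
  by apply: (le_trans (ltW lt)); rewrite ler_nat.
have a0 : 0 < a%:R :> R by apply: lt_le_trans aY; exact: expR_gt0.
set x := ln (a%:R : R).
have ax : a%:R = expR x by rewrite /x lnK ?posrE.
have xY : expR Y <= x by rewrite -ler_expR -ax.
have x0 : 0 < x by apply: lt_le_trans xY; exact: expR_gt0.
set y := ln x; have xE : x = expR y by rewrite /y lnK ?posrE.
have yY : Y <= y by rewrite -ler_expR -xE.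
have [g1 g2] := growth_estimates e0 e1 C1 yY; rewrite -!xE in g1 g2.
have x10 : 10 <= x by rewrite xE; have := expR_ge1Dx y; lra.
have y0 : 0 < y by lra.
set u := (1 - eps) * (x / y) in g1 *.
have u0 : 0 <= u by rewrite mulr_ge0 ?divr_ge0 ?(ltW x0) ?(ltW y0) //; lra.
(* [K > u + 2] provides the factor 4. As [N > 2 x] and [ln 2 >= 1 / 2], fewer than [K] primes up to
   [2 N] would force [x < N ln 2 <= K ln (2 N) <= (1 - eps / 2) x]. *)
pose K := (Num.truncn u).+3; pose N := (Num.truncn (2 * x)).+1.
have /andP[Nlow Nup] := truncn_itv (mulr_ge0 (ler0n R 2) (ltW x0)).
have /andP[Klow Kup] := truncn_itv u0.
have KE : K%:R = (Num.truncn u)%:R + 3 :> R by rewrite /K -addn3 natrD.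
have NE : N%:R = (Num.truncn (2 * x))%:R + 1 :> R by rewrite /N -natr1.
rewrite -natr1 in Kup.
have ln2N : ln ((N.*2)%:R : R) <= y + 3.
  have -> : y + 3 = ln (expR (y + 3)) by rewrite expRK.
  rewrite ler_ln ?posrE ?expR_gt0 ?ltr0n ?double_gt0 // expRD -xE.
  have : 8 <= expR 3 :> R.
    have -> : 3 = 3%:R * 1 :> R by rewrite mulr1.
    rewrite expRM_natl; have := expR_ge1Dx (1 : R) => h.
    have -> : 8 = 2 ^+ 3 :> R by ring.
    by apply: lerXn2r; rewrite ?nnegrE ?expR_ge0 //; lra.
  rewrite -muln2 natrM NE => h8.
  have : x * 8 <= x * expR 3 by rewrite ler_wpM2l // ltW.
  by lra.
have N2 : 1 < (N.*2)%:R :> R by rewrite ltr1n.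
have lnN0 : 0 < ln ((N.*2)%:R : R) by rewrite ln_gt0.
have Kln : K%:R * ln ((N.*2)%:R : R) <= (1 - eps / 2) * x.
  apply: (le_trans _ g1); apply: ler_pM => //; first exact: ltW.
  by rewrite KE; lra.
pose Q := [seq p <- iota 0 N.*2.+1 | prime p].
have KQ : (K <= size Q)%N.
  rewrite leqNgt; apply/negP => lt.
  have h : 2 ^+ N <= N.*2%:R ^+ K :> R.
    rewrite -!natrX ler_nat; apply: (leq_trans (expn2_le_primes (ltn0Sn _))).
    by rewrite leq_pexp2l ?double_gt0 // ltnW.
  have : ln (2 ^+ N : R) <= ln (N.*2%:R ^+ K : R).
    by rewrite ler_ln ?posrE ?exprn_gt0 // (lt_trans _ N2).
  rewrite !lnXn // ?(lt_trans _ N2) // -[_ *+ N]mulr_natl -[_ *+ K]mulr_natl => h2.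
  have NX : 2 * x < N%:R := Nup.
  have NL : N%:R * 2^-1 <= N%:R * ln 2 :> R by rewrite ler_wpM2l // ln2_ge.
  have ex : 0 <= eps * x by rewrite mulr_ge0 // ltW.
  exact: (aux _ _ _ _ _ NL ex h2 Kln NX).
pose P := take K Q.
have sP : size P = K by rewrite size_takel.
exists P; split.
- by rewrite take_uniq // filter_uniq // iota_uniq.
- by apply/allP => p /mem_take; rewrite mem_filter => /andP[].
- rewrite sP (_ : 4 = 2 `^ 2%:R); last by rewrite powR_mulrn //; ring.
  rewrite -powRD; last by apply/implyP.
  rewrite -powR_mulrn // ler_powR ?ler1n //; rewrite -/u KE; lra.
set D := (\prod_(i <- P) i)%N.
have DN : (D <= N.*2 ^ K)%N.
  rewrite -sP /D; have : all (fun p => p <= N.*2)%N P.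
    by apply/allP => p /mem_take; rewrite mem_filter mem_iota => /andP[_ /andP[_]].
  elim: (P) => [|p s IH] /=; first by rewrite big_nil.
  by move=> /andP[hp hs]; rewrite big_cons expnS leq_mul // IH.
have D0 : (0 < D)%N.
  rewrite /D big_seq prodn_cond_gt0 // => p /mem_take.
  by rewrite mem_filter => /andP[/prime_gt0].
have Dexp : D%:R <= expR ((1 - eps / 2) * x).
  apply: (le_trans _ (_ : expR (K%:R * ln ((N.*2)%:R : R)) <= _)); last by rewrite ler_expR.
  by rewrite expRM_natl lnK ?posrE ?(lt_trans _ N2) // -natrX ler_nat.
pose k := (G * D)%N; rewrite -/k.
have k0 : (0 < k)%N by rewrite muln_gt0 G0.
have lnk : ln ((64 * k)%:R : R) <= C + x.
  have -> : (64 * k)%:R = C * D%:R by rewrite /C /k !natrM mulrA.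
  have C0 : 0 < C by lra.
  have Dr : 0 < D%:R :> R by rewrite ltr0n.
  rewrite lnM ?posrE //; apply: lerD; first by apply/ltW/ln_sublinear.
  apply: (@le_trans _ _ (ln (expR ((1 - eps / 2) * x)))).
    by rewrite ler_ln ?posrE ?expR_gt0.
  by rewrite expRK ler_piMl ?(ltW x0) //; lra.
have kC : (12 * k)%:R <= C * D%:R :> R.
  rewrite /C /k !natrM mulrA ler_wpM2r // ler_wpM2r //; lra.
have main : (12 * k)%:R * ln ((64 * k)%:R : R) <= 1 / 4 * a%:R.
  apply: (@le_trans _ _ ((C * D%:R) * (C + x))).
    apply: ler_pM => //; apply: ln_ge0; rewrite ler1n muln_gt0 k0 //.
  rewrite mulrAC; apply: (@le_trans _ _ (C * (C + x) * (expR (- (eps / 2 * x)) * expR x))).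
    rewrite -expRD (_ : - (eps / 2 * x) + x = (1 - eps / 2) * x); last by ring.
    by rewrite ler_wpM2l // mulr_ge0 //; lra.
  by rewrite mulrA ax ler_wpM2r ?expR_ge0.
have a4 : 8 <= a%:R :> R by rewrite ax; have := expR_ge1Dx x; lra.
have kk : 0 < (64 * k)%:R :> R by rewrite ltr0n muln_gt0.
rewrite -(ler_nat R).
have -> : (2 * (64 * k) ^ (12 * k))%:R = 2 * (64 * k)%:R ^+ (12 * k) :> R by rewrite natrM natrX.
rewrite natrX -ler_ln ?posrE ?mulr_gt0 ?exprn_gt0 // lnM ?posrE ?exprn_gt0 // !lnXn //.
rewrite -[_ *+ (12 * k)]mulr_natl -[_ *+ a.-1]mulr_natl.
have a1 : a.-1%:R = a%:R - 1 :> R.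
  by rewrite -[in RHS](@prednK a) -?natr1 ?addrK // -(ltr_nat R).
have l2 := ln2_ge; have l1 := ln2_le1.
have : (a%:R - 1) * 2^-1 <= (a%:R - 1) * ln (2 : R) by rewrite ler_wpM2l //; lra.
rewrite a1; move: main l1 a4; clear; lra.
Qed.

End LogEstimates.

(** * Elimination *)

Lemma common_denominator (I : finType) (v : I -> rat) :
  exists Q : nat, (0 < Q)%N /\ exists z : I -> int, forall i, Q%:R * v i = (z i)%:~R.
Proof.
exists (\prod_i `|denq (v i)|)%N; split.
  by rewrite prodn_gt0 // => i; rewrite absz_gt0 denq_neq0.
exists (fun i => (\prod_(j | j != i) `|denq (v j)|)%N%:Z * numq (v i)) => i.
rewrite (bigD1 i) //= natrM rmorphM /= -pmulrn mulrAC mulrC; congr (_ * _).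
by rewrite pmulrn absz_denq mulrC numqE.
Qed.

(** Fewer equations than unknowns: a rational kernel vector exists, and its denominators are
    cleared. *)
Lemma elimination (J : finType) (S : seq nat) (x : J -> nat) : (size S < #|J|)%N ->
  exists w : J -> int, (exists i, w i != 0) /\
    forall s, s \in S -> \sum_i w i * (x i)%:Z ^+ s = 0.
Proof.
move=> SJ; pose M : 'M[rat]_(#|J|, size S) := \matrix_(i, j) (x (enum_val i))%:R ^+ nth 0%N S j.
have kn0 : kermx M != 0.
  by rewrite -mxrank_eq0 mxrank_ker subn_eq0 -ltnNge (leq_ltn_trans (rank_leq_col M)).
pose v := nz_row (kermx M).
have v0 : v != 0 by rewrite nz_row_eq0.
have vM : v *m M = 0 by apply/eqP; rewrite -sub_kermx nz_row_sub.
have [Q [Q0 [z zE]]] := common_denominator (fun i : J => v 0 (enum_rank i)).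
have Qr : Q%:R != 0 :> rat by rewrite pnatr_eq0 -lt0n.
exists z; split.
  have [j vj] : exists j, v 0 j != 0 by apply/rV0Pn.
  exists (enum_val j); rewrite -(intr_eq0 rat) -zE enum_valK mulf_neq0 //.
move=> s sS; apply/eqP; rewrite -(intr_eq0 rat) rmorph_sum /=; apply/eqP.
have iS : (index s S < size S)%N by rewrite index_mem.
have := congr1 (fun A : 'rV_(size S) => Q%:R * A 0 (Ordinal iS)) vM.
rewrite !mxE mulr0 mulr_sumr => h; rewrite -[RHS]h.
rewrite (reindex (@enum_val J J)) /=; last first.
  by exists enum_rank => i _; rewrite ?enum_valK ?enum_rankK.
apply: eq_bigr => i _; rewrite !mxE nth_index // rmorphM rmorphXn /= -zE enum_valK mulrA //.
Qed.

Section SubsetProducts.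
Variables (P : seq nat).
Hypotheses (P_uniq : uniq P) (P_prime : all prime P).

(** Indexing the squarefree divisors by sets of primes makes their number [2 ^ size P] the cardinal
    of a finite type. *)
Definition subset_prod (A : {set 'I_(size P)}) : nat := (\prod_(i in A) nth 0 P i)%N.

Lemma subset_prod_dvd A : (subset_prod A %| \prod_(i <- P) i)%N.
Proof.
rewrite (big_nth 0%N) big_mkord (bigID (fun i => i \in A)) /=; exact: dvdn_mulr.
Qed.

Lemma dvd_subset_prod A (i : 'I_(size P)) : (nth 0 P i %| subset_prod A)%N = (i \in A).
Proof.
have pi (j : 'I_(size P)) : prime (nth 0%N P j) by apply: (allP P_prime); exact: mem_nth.
apply/idP/idP => [|iA]; last by rewrite /subset_prod (bigD1 i) //= dvdn_mulr.
rewrite /subset_prod; apply: contraLR => iA; rewrite -prime_coprime //.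
apply: (big_ind (fun x => coprime _ x)) => [|x y|j jA].
- exact: coprimen1.
- by rewrite coprimeMr => -> ->.
rewrite prime_coprime // dvdn_prime2 // nth_uniq //.
by apply: contra iA => /eqP /val_inj ->.
Qed.

Lemma subset_prod_inj : injective subset_prod.
Proof.
by move=> A B AB; apply/setP => i; rewrite -!dvd_subset_prod AB.
Qed.

End SubsetProducts.

(** * The theorem *)

Section RealValues.
Variable R : realType.

Lemma tends_of_cvg (u : nat -> R) (l : R) : u @ \oo --> l -> tends u l.
Proof.
move=> /cvgrPdist_le h eps e0; have [M0 _ hM] := h _ e0.
by exists M0 => M MM; rewrite distrC; apply: hM.
Qed.

Lemma Lpart_cvg (f : int -> R) (F : R) s : (forall x, `|f x| <= F) -> (2 <= s)%N ->
  exists l, tends (Lpart f s) l.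
Proof.
move=> fF s2; have F0 : 0 <= F by apply: le_trans (fF 0).
pose u (m : nat) : R := f m.+1%:Z / m.+1%:R ^+ s.
have cv : cvgn (series u).
  apply: normed_cvg; apply: nondecreasing_is_cvgn.
    by apply: nondecreasing_series => m _ _; exact: normr_ge0.
  exists (F * 2) => _ [M _ <-]; rewrite /= /series /=.
  apply: (@le_trans _ _ (\sum_(0 <= m < M) F * (m.+1%:R ^+ 2)^-1)); last first.
    by rewrite -mulr_sumr ler_wpM2l // sum_inv_sqr_le.
  apply: ler_sum => m _; rewrite normrM normfV normrX normr_nat ler_pM ?invr_ge0 ?exprn_ge0 //.
  by rewrite lef_pV2 ?posrE ?exprn_gt0 ?ltr0n // ler_weXn2l // ler1n.
by exists (limn (series u)); apply: tends_of_cvg.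
Qed.

(** The pair of real limits is shown to be the complex limit: errors of at most [er / 2] in both
    parts give a modulus of at most [er]. *)
Lemma Lseries_tends (f : int -> R[i]) (F : R) s :
  (forall x, `|complex.Re (f x)| <= F) -> (forall x, `|complex.Im (f x)| <= F) -> (2 <= s)%N ->
  tends (Lpart (fun x => complex.Re (f x)) s) (complex.Re (Lseries f s)) /\
  tends (Lpart (fun x => complex.Im (f x)) s) (complex.Im (Lseries f s)).
Proof.
move=> f1 f2 s2; have [l1 h1] := Lpart_cvg f1 s2; have [l2 h2] := Lpart_cvg f2 s2.
suff -> : Lseries f s = (l1 +i* l2)%C by [].
rewrite /Lseries; set u : nat -> R[i]^o := series _.
have uE M : u M = (Lpart (fun x => complex.Re (f x)) s M +i* Lpart (fun x => complex.Im (f x)) s M)%C.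
  rewrite /u /series /= /Lpart; elim: M => [|M IH]; first by rewrite !big_nil.
  rewrite !big_nat_recr //= IH.
  have -> : f M.+1%:Z / M.+1%:R ^+ s = f M.+1%:Z * ((M.+1%:R ^+ s)^-1%:C)%C.
    by rewrite rmorphV ?unitfE ?expf_neq0 ?pnatr_eq0 // rmorphXn /= rmorph_nat.
  by case: (f M.+1) => x y; simpc.
apply: (@cvg_lim (R[i]^o)); first exact: norm_hausdorff.
apply/(@cvgrPdist_le R[i] R[i]^o) => eps e0.
have [er e_gt0 eE] : exists2 er : R, 0 < er & eps = (er%:C)%C.
  exists (complex.Re eps); first by move: e0; rewrite ltcE /= => /andP[].
  by apply/eqP; rewrite eq_complex /= eqxx /=; move: e0; rewrite ltcE /= => /andP[].
have e2 : 0 < er / 2 by rewrite divr_gt0.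
have [M1 H1] := h1 _ e2; have [M2 H2] := h2 _ e2.
exists (maxn M1 M2) => // M /=; rewrite geq_max => /andP[/H1 k1 /H2 k2].
rewrite uE eE normc_def /= lecR.
have sq (x y : R) : `|y - x| <= er / 2 -> (x - y) ^+ 2 <= (er / 2) ^+ 2.
  move=> h; rewrite -[(x - y) ^+ 2]real_normK ?num_real // distrC.
  by apply: lerXn2r; rewrite ?nnegrE // ltW.
rewrite -[X in _ <= X](ger0_norm (ltW e_gt0)) -sqrtr_sqr ler_wsqrtr //.
have := sq _ _ k1; have := sq _ _ k2; have : 0 <= er ^+ 2 by rewrite sqr_ge0.
rewrite expr_div_n; lra.
Qed.

(** [S] lists the exceptional exponents. The family [b] is arbitrary, since the real parts of a
    rationally free complex family may be dependent. *)
Lemma real_case (T d : nat) (eps : R) : (0 < T)%N -> 0 < eps -> exists a0 : nat,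
  forall (f : int -> R) (Lf : nat -> R) (b : 'I_d -> R) (p a : nat) (S : seq nat),
  (forall x : int, f (x + T%:Z) = f x) -> (exists x, f x != 0) -> (p <= 1)%N -> (a0 <= a)%N ->
  (forall s, (2 <= s)%N -> tends (Lpart f s) (Lf s)) ->
  (forall s, (2 <= s <= a)%N -> odd s = odd p -> s \notin S ->
     exists c : 'I_d -> rat, Lf s = \sum_l ratr (c l) * b l) ->
  2 `^ ((1 - eps) * (ln (a%:R : R) / ln (ln (a%:R : R)))) <= (size S)%:R.
Proof.
(* For [eps > 1] the bound with [eps = 1] is at least as strong, the quotient of logarithms being
   nonnegative for [a >= 8]. *)
move=> T0 eps0; pose e1 := Num.min eps 1.
have e1_gt0 : 0 < e1 by rewrite lt_min eps0 ltr01.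
have e1_le1 : e1 <= 1 by rewrite ge_min lexx orbT.
pose g := (20 * (d + T) + 6)%N.
have G0 : (0 < 2 ^ g * T)%N by rewrite muln_gt0 expn_gt0.
have [a1 ha1] := many_divisors e1_gt0 e1_le1 G0.
exists (maxn a1 8) => f Lf b p a S fT fnz p1; rewrite geq_max => /andP[a1a a8] Lf_lim Sspan.
have [P [P_uniq P_prime Pbig Psmall]] := ha1 a a1a.
set Z := ln (a%:R : R) / ln (ln (a%:R : R)) in Pbig *.
have Z0 : 0 <= Z.
  have l8 : 1 <= ln (a%:R : R).
    apply: (@le_trans _ _ (ln ((2 : R) ^+ 3))).
      by rewrite lnXn // -[_ *+ 3]mulr_natl; have := ln2_ge R; lra.
    by rewrite ler_ln ?posrE ?exprn_gt0 ?ltr0n ?(leq_trans _ a8) // -natrX ler_nat.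
  by apply: divr_ge0; [exact: (le_trans ler01 l8) | exact: ln_ge0].
apply: (@le_trans _ _ (2 `^ ((1 - e1) * Z))).
  by rewrite ler_powR ?ler1n // ler_wpM2r // lerB // ge_min lexx.
rewrite leNgt; apply/negP => small.
have z1 : 1 <= 2 `^ ((1 - e1) * Z) :> R.
  by rewrite -[X in X <= _](powRr0 2) ler_powR ?ler1n // mulr_ge0 // subr_ge0.
pose D := (\prod_(i <- P) i)%N.
have D0 : (0 < D)%N.
  by rewrite /D big_seq prodn_cond_gt0 // => i iP; rewrite prime_gt0 // (allP P_prime).
pose J : finType := {set 'I_(size P)}.
pose e : J -> nat := @subset_prod P.
have SJ : (size (1%N :: S) < #|J|)%N.
  rewrite -cardsT -powersetT card_powerset cardsT card_ord -(ltr_nat R) natrX /= -natr1.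
  by apply: lt_le_trans Pbig; lra.
have [w [wnz w0]] := elimination (fun i : J => ((D * T) %/ e i)%N) SJ.
have [c cE] : exists c : nat -> 'I_d -> rat, forall s, (2 <= s <= a)%N -> odd s = odd p ->
    s \notin S -> Lf s = \sum_l ratr (c s l) * b l.
  have h s : exists c : 'I_d -> rat, (2 <= s <= a)%N -> odd s = odd p -> s \notin S ->
      Lf s = \sum_l ratr (c l) * b l.
    have [[s2 [sp sS]]|n] := pselect ((2 <= s <= a)%N /\ odd s = odd p /\ s \notin S).
      by have [c hc] := Sspan s s2 sp sS; exists c.
    by exists (fun=> 0) => h1 h2 h3; case: n.
  by have [c hc] := choice h; exists c.
have [Q0 [Q0_gt0 [z zE]]] := common_denominator (fun i : 'I_a.+1 * 'I_d => c i.1 i.2).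
(* The largest odd number up to [a], since the parity argument takes poles of odd order. *)
pose b' := if odd a then a else a.-1.
have b'_odd : odd b'.
  rewrite /b'; case: ifP => //; case: (a) a8 => // a' _ /=; by case: (odd a').
have b'a : (b' <= a)%N by rewrite /b'; case: ifP => // _; exact: leq_pred.
have ab' : (a.-1 <= b')%N by rewrite /b'; case: ifP => // _; exact: leq_pred.
pose k := (2 ^ g * (D * T))%N.
have kE : k = (2 ^ g * T * D)%N by rewrite /k [(D * T)%N]mulnC mulnA.
have hb : (2 * (64 * k) ^ (12 * k) <= 2 ^ b')%N.
  by rewrite kE; apply: (leq_trans Psmall); rewrite leq_exp2l.
apply: (@no_dependence R k b' T D d p Q0 g f J e w b Lf (fun s l => z (inord s, l))) => //.
- exact: subset_prod_inj.
- by move=> A; apply: subset_prod_dvd.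
- by rewrite /weight; have := w0 1%N (mem_head _ _).
- move=> s /andP[s2 sb'] sp ws.
  have sa : (s <= a)%N by apply: leq_trans b'a.
  have sS : s \notin S.
    by apply: contra ws => sS; rewrite /weight w0 // in_cons sS orbT.
  rewrite cE ?s2 // mulr_sumr; apply: eq_bigr => l _; rewrite mulrA; congr (_ * _).
  have := congr1 (fun x : rat => ratr x : R) (zE (inord s, l)).
  by rewrite /= rmorphM /= ratr_nat ratr_int inordK.
Qed.

End RealValues.

Theorem theorem2 (R : realType) (T d : nat) (eps : R)
    (hT : (1 <= T)%N) (heps : 0 < eps) :
  exists a0 : nat,
    forall (f : int -> R[i]) (E : set R[i]) (p a : nat),
      (forall n : int, f (n + T%:Z) = f n) ->
      (exists n : int, f n != 0) ->
      rat_subspace_dim E d ->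
      (p = 0 \/ p = 1)%N ->
      (a0 <= a)%N ->
      2 `^ ((1 - eps) * (ln (a%:R : R) / ln (ln (a%:R : R)))) <=
      #|[pred s : 'I_a.+1 | [&& (2 <= s)%N, (s == p %[mod 2])%N
                              & Lseries f s \notin E]]|%:R :> R.
Proof.
have [a0 ha0] := real_case d hT heps; exists a0 => f E p a fT [n0 fn0] [b [_ ->]] hp a0a.
have p1 : (p <= 1)%N by case: hp => ->.
set X := [pred s : 'I_a.+1 | _].
pose S := [seq nat_of_ord s | s <- enum X].
have sS : size S = #|X| by rewrite size_map cardE.
have [F fRe fIm] : exists2 F : R, forall x, `|complex.Re (f x)| <= F & forall x, `|complex.Im (f x)| <= F.
  have [F1 h1] := periodic_bounded hT (fun x => congr1 (@complex.Re R) (fT x)).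
  have [F2 h2] := periodic_bounded hT (fun x => congr1 (@complex.Im R) (fT x)).
  by exists (Num.max F1 F2) => x; rewrite le_max ?h1 ?h2 ?orbT.
have inS s : (2 <= s <= a)%N -> odd s = odd p -> s \notin S ->
    exists c : 'I_d -> rat, Lseries f s = \sum_l ratr (c l) * b l.
  move=> /andP[s2 sa] sp; apply: contraNP => nex.
  apply/mapP; exists (inord s); last by rewrite inordK.
  rewrite mem_enum inE inordK // s2 /= !modn2 sp eqxx /=.
  apply/negP; rewrite inE /rat_span /= => -[c cE]; apply: nex; by exists c.
have Re_ratr (q : rat) (x : R[i]) : complex.Re (ratr q * x) = ratr q * complex.Re x.
  by rewrite -(fmorph_rat (real_complex R)); case: x => u v; rewrite /= mul0r subr0.
have Im_ratr (q : rat) (x : R[i]) : complex.Im (ratr q * x) = ratr q * complex.Im x.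
  by rewrite -(fmorph_rat (real_complex R)); case: x => u v; rewrite /= mul0r addr0.
rewrite -sS.
(* One of the two parts of [f] is nonzero at [n0]. Rational combinations pass to real and imaginary
   parts with the same coefficients, so the number of generators stays [d] instead of becoming
   [2 d]. *)
have [Re0|Re0] := eqVneq (complex.Re (f n0)) 0.
  apply: (ha0 (fun x => complex.Im (f x)) (fun s => complex.Im (Lseries f s))
     (fun l => complex.Im (b l)) p a S) => //.
  - by move=> x; rewrite fT.
  - exists n0; apply: contra fn0 => /eqP Im0; by apply/eqP/eqP; rewrite eq_complex Re0 Im0 /= eqxx.
  - by move=> s s2; have [] := Lseries_tends fRe fIm s2.
  - move=> s h1 h2 h3; have [c ->] := inS s h1 h2 h3; exists c.
    by rewrite raddf_sum; apply: eq_bigr => l _; apply: Im_ratr.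
apply: (ha0 (fun x => complex.Re (f x)) (fun s => complex.Re (Lseries f s))
   (fun l => complex.Re (b l)) p a S) => //.
- by move=> x; rewrite fT.
- by exists n0.
- by move=> s s2; have [] := Lseries_tends fRe fIm s2.
- move=> s h1 h2 h3; have [c ->] := inS s h1 h2 h3; exists c.
  by rewrite raddf_sum; apply: eq_bigr => l _; apply: Re_ratr.
Qed.
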